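(* (Second order density matrix perturbation formula.) Let $H(\varepsilon)$ be an $n\times n$ Hermitian matrix depending on real parameters $\varepsilon=(\varepsilon_1,\dots,\varepsilon_r)$ and twice differentiable at $\varepsilon=0$. Let $\mu\in\mathbb{R}$ and let $f(x)=1$ if $x<\mu$ and $f(x)=0$ otherwise. Let $\lambda_1\le\dots\le\lambda_n$ be the eigenvalues of $H(0)$, assume that $H(0)$ has no eigenvalues in a neighborhood of $\mu$, and assume that $\lambda_{n_e}<\mu<\lambda_{n_e+1}$ with $1\le n_e<n$. Let $Q$ be unitary with $Q^*H(0)Q=\mathrm{diag}(\lambda_1,\dots,\lambda_n)$, and split $Q=[Q_{\mathrm{occ}}\ Q_{\mathrm{vir}}]$ where $Q_{\mathrm{occ}}$ consists of the first $n_e$ columns. For multi-indices $\alpha$ with $|\alpha|\le 2$ write $H^{(\alpha)}=\partial^\alpha H(\varepsilon)|_{\varepsilon=0}$ and $P^{(\alpha)}=\partial^\alpha f(H(\varepsilon))|_{\varepsilon=0}$. Let $D$ be the $n\times n$ matrix with entries $D_{ij}=-1/|\lambda_i-\lambda_j|$ if $(\lambda_i-\mu)(\lambda_j-\mu)<0$ and $D_{ij}=0$ otherwise. Then, for $\alpha=\beta+\gamma$ with $|\beta|=|\gamma|=1$, $$Q^*P^{(\alpha)}Q = D\circ\begin{bmatrix}0 & M_{12}\\ M_{21} & 0\end{bmatrix}+\begin{bmatrix}-Q_{\mathrm{occ}}^*(P^{(\beta)}P^{(\gamma)}+P^{(\gamma)}P^{(\beta)})Q_{\mathrm{occ}} &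 0\\ 0 & Q_{\mathrm{vir}}^*(P^{(\beta)}P^{(\gamma)}+P^{(\gamma)}P^{(\beta)})Q_{\mathrm{vir}}\end{bmatrix},$$ where $$M_{12}=Q_{\mathrm{occ}}^*\big(H^{(\alpha)}+P^{(\beta)}H^{(\gamma)}-H^{(\beta)}P^{(\gamma)}+P^{(\gamma)}H^{(\beta)}-H^{(\gamma)}P^{(\beta)}\big)Q_{\mathrm{vir}},$$ $$M_{21}=Q_{\mathrm{vir}}^*\big(H^{(\alpha)}+H^{(\beta)}P^{(\gamma)}-P^{(\beta)}H^{(\gamma)}+H^{(\gamma)}P^{(\beta)}-P^{(\gamma)}H^{(\beta)}\big)Q_{\mathrm{occ}}.$$
   Context: $\circ$ denotes the Hadamard (entrywise) product. For Hermitian $H$, $f(H)$ is the matrix function in the standard sense (apply $f$ to the eigenvalues in an eigendecomposition). *)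

(* Defs.v *)
From HB Require Import structures.
From mathcomp Require Import all_boot all_order all_algebra complex.
From mathcomp Require Import all_classical all_reals all_analysis.
Set Implicit Arguments.
Unset Strict Implicit.
Unset Printing Implicit Defensive.
Import Order.TTheory GRing.Theory Num.Theory numFieldNormedType.Exports.
Local Open Scope ring_scope.
Local Open Scope complex_scope.
Local Open Scope sesquilinear_scope.
Local Open Scope classical_set_scope.

(* f(A) for Hermitian A and f : R -> R, through the unitary diagonalization
   A = U^* diag(d) U with U = spectralmx A and d = spectral_diag A; since d is
   real, taking real parts loses nothing. The value does not depend on the
   chosen diagonalization. *)
Definition hermfun (R : realType) (n : nat) (f : R -> R) (A : 'M[R[i]]_n) :
    'M[R[i]]_n :=
  (spectralmx A)^t* *m
    diag_mx (map_mx (fun z : R[i] => (f (complex.Re z))%:C) (spectral_diag A))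
    *m spectralmx A.

Definition occupation (R : realType) (mu x : R) : R :=
  if x < mu then 1 else 0.

Definition hadamard (R : realType) (m n : nat) (A B : 'M[R[i]]_(m, n)) :
    'M[R[i]]_(m, n) := map2_mx *%R A B.

(* h is Frechet differentiable near a, and its derivative e |-> 'd h e is
   differentiable at a. As 'rV[R]_r is finite-dimensional, the latter amounts to
   differentiability at a of e |-> 'd h e v = 'D_v h e for every v. *)
Definition twice_differentiable (R : realType) (r : nat)
    (h : 'rV[R]_r -> R) (a : 'rV[R]_r) : Prop :=
  (\forall e \near a, differentiable h e) /\
  (forall v : 'rV[R]_r, differentiable (fun e => 'D_v h e) a).

(* Complex matrices are differentiated with respect to real parameters through
   the real and imaginary parts of their entries. *)
Definition mx_twice_differentiable (R : realType) (r m n : nat)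
    (F : 'rV[R]_r -> 'M[R[i]]_(m, n)) (a : 'rV[R]_r) : Prop :=
  forall i j,
    twice_differentiable (fun e => complex.Re (F e i j)) a /\
    twice_differentiable (fun e => complex.Im (F e i j)) a.

Definition pderiv (R : realType) (r m n : nat) (k : 'I_r)
    (F : 'rV[R]_r -> 'M[R[i]]_(m, n)) (e : 'rV[R]_r) : 'M[R[i]]_(m, n) :=
  \matrix_(i, j) ('D_(delta_mx 0 k) (fun x => complex.Re (F x i j)) e
               +i* 'D_(delta_mx 0 k) (fun x => complex.Im (F x i j)) e).

Definition mdegree (r : nat) (alpha : {ffun 'I_r -> nat}) : nat :=
  (\sum_(k < r) alpha k)%N.

(* partial_0^(alpha 0) (partial_1^(alpha 1) (... F)) *)
Definition mpderiv (R : realType) (r m n : nat) (alpha : {ffun 'I_r -> nat})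
    (F : 'rV[R]_r -> 'M[R[i]]_(m, n)) : 'rV[R]_r -> 'M[R[i]]_(m, n) :=
  foldr (fun k G => iter (alpha k) (@pderiv R r m n k) G) F (enum 'I_r).

(* Main.v *)
Require Import Defs.
From HB Require Import structures.
From mathcomp Require Import all_boot all_order all_algebra complex.
From mathcomp Require Import all_classical all_reals all_analysis.
From mathcomp Require Import ring lra.
Set Implicit Arguments.
Unset Strict Implicit.
Import Order.TTheory GRing.Theory Num.Theory numFieldNormedType.Exports.
Local Open Scope ring_scope.
Local Open Scope complex_scope.
Local Open Scope sesquilinear_scope.
Local Open Scope classical_set_scope.

(* Write B = |H - mu| = (H - mu) (1 - 2 P). For parameters e and a,
     B(e) (P(e) - P(a)) + (P(e) - P(a)) B(a)
       = - (P(e) (H(e) - H(a)) (1 - P(a)) + (1 - P(e)) (H(e) - H(a)) P(a)),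
   a Sylvester equation whose operator is bounded below by the spectral gap, in
   Frobenius norm. It therefore carries continuity and differentiability from H
   to P, and it expresses the first derivatives of P near 0 as solutions of
   Sylvester equations with differentiable data, so that P is twice
   differentiable at 0. Differentiating P P = P twice gives the diagonal blocks
   of the second derivative of P, and differentiating H P = P H twice gives the
   off-diagonal ones. *)

(** Eigenvectors of [H e] may jump with [e], [spectralmx] is an arbitrary choice and [occupation mu]
    is discontinuous, so the formula defining [hermfun] gives no regularity. Algebraic identities
    between functions of a matrix do not see that choice, and the proof moves everything into such
    identities. The factor [1 - 2 P] is the sign that makes [H - mu] positive: sums of two
    eigenvalues of [H - mu] can vanish, sums of their absolute values cannot once there is a gap. As
    [B(e)] is nonnegative for every [e], a gap at [a] alone controls the operator that pairs [e]
    with [a]. Differentiability is handled as an exact identity, an increment being a sum of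
    coordinates of [e - a] times slopes continuous at [a]. The Sylvester equation is linear in
    [H(e) - H(a)], so solving it for each slope of [H] yields the slopes of [P], with no remainder
    to estimate. The first derivatives are thereby known at every point near 0, because the gap
    survives there with half its size; this is the formula that is differentiated again. *)

Lemma continuous_at_sum (R : realType) (T : topologicalType) (I : Type)
    (s : seq I) (p : pred I) (f : I -> T -> R) (a : T) :
  (forall i, p i -> {for a, continuous (f i)}) ->
  {for a, continuous (fun x => \sum_(i <- s | p i) f i x)}.
Proof. by move=> fc; apply: cvg_big => //; exact: add_continuous. Qed.

Lemma continuous_atM (R : realType) (T : topologicalType) (f g : T -> R)
    (a : T) :
  {for a, continuous f} -> {for a, continuous g} ->
  {for a, continuous (fun x => f x * g x)}.
Proof. by move=> fc gc; apply: cvgM. Qed.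

Lemma continuous_atD (R : realType) (T : topologicalType) (f g : T -> R)
    (a : T) :
  {for a, continuous f} -> {for a, continuous g} ->
  {for a, continuous (fun x => f x + g x)}.
Proof. by move=> fc gc; apply: cvgD. Qed.

Lemma continuous_atN (R : realType) (T : topologicalType) (f : T -> R)
    (a : T) :
  {for a, continuous f} -> {for a, continuous (fun x => - f x)}.
Proof. by move=> fc; apply: cvgN. Qed.

(** Caratheodory's criterion: replacing each [phi k e] by [phi k a] leaves a linear map, and
    continuity of the slopes makes the error small against [e - a]. *)
Lemma slopes_differentiable (R : realType) (r : nat) (h : 'rV[R]_r -> R)
    (a : 'rV[R]_r) (phi : 'I_r -> 'rV[R]_r -> R) :
  (forall k, {for a, continuous (phi k)}) ->
  (\forall e \near a, h e - h a = \sum_k (e - a) 0 k * phi k e) ->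
  differentiable h a /\ forall v, 'D_v h a = \sum_k v 0 k * phi k a.
Proof.
move=> phic hE.
pose g (v : 'rV[R]_r) : R := \sum_k v 0 k * phi k a.
have glin : linear g.
  move=> c u v; rewrite /g scaler_sumr -big_split /=; apply: eq_bigr => k _.
  by rewrite !mxE mulrDl scalerAl.
pose gM := GRing.isLinear.Build _ _ _ _ _ glin.
pose gL : {linear 'rV[R]_r -> R} := HB.pack g gM.
have gc : continuous gL.
  move=> x; apply: continuous_at_sum => k _.
  by apply: continuous_atM; [exact: coord_continuous|exact: cst_continuous].
have ho : h \o shift a = cst (h a) + (gL : 'rV[R]_r -> R^o) +o_ (0 : 'rV[R]_r) id.
  apply/eqaddoP => eps eps0.
  suff H : \forall e \near a, `|h e - h a - g (e - a)| <= eps * `|e - a|.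
    rewrite [\forall x \near _, _ <= _](near_shift a 0) sub0r; apply: filterS H => e /=.
    by rewrite !fctE /= subrK opprD addrA.
  (* The remainder has [r] terms, so this share keeps their sum below [eps]; the successor avoids
     dividing by zero when [r = 0]. *)
  have r0 : 0 < eps / (r.+1)%:R by rewrite divr_gt0.
  have phin : \forall e \near a, forall k, `|phi k a - phi k e| <= eps / (r.+1)%:R.
    apply: (@filter_forall _ _ (fun k e => `|phi k a - phi k e| <= _) (nbhs a) _) => k.
    have /cvgrPdist_le/(_ _ r0) := phic k; exact.
  near=> e.
  have -> : h e - h a = \sum_k (e - a) 0 k * phi k e by near: e.
  have phie k : `|phi k a - phi k e| <= eps / (r.+1)%:R by move: k; near: e.
  rewrite /g -sumrB (le_trans (ler_norm_sum _ _ _)) //.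
  have : \sum_(k < r) `|(e - a) 0 k * phi k e - (e - a) 0 k * phi k a| <=
     \sum_(k < r) `|e - a| * (eps / (r.+1)%:R).
    apply: ler_sum => k _; rewrite -mulrBr normrM ler_pM //.
      rewrite [leRHS]/Num.Def.normr/= mx_normrE.
      by apply: (le_bigmax _ (fun i => `|(e - a) i.1 i.2|) (0, k)).
    by rewrite distrC.
  move=> /le_trans; apply; rewrite sumr_const card_ord -mulrnAr mulrC.
  rewrite ler_wpM2r // -mulr_natr -mulrA ler_piMr ?ltW //=.
  by rewrite mulrC ltr_pdivrMr // mul1r ltr_nat.
have dg : 'd h a = gL :> (_ -> _) by exact: diff_unique.
have dh : differentiable h a by apply/diff_locallyP; rewrite dg.
by split=> // v; rewrite deriveE // dg.
Unshelve. all: by end_near.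
Qed.

(* The remainder [rho] of a differentiable [h] is spread over the coordinates by
   the weights [(e - a)_k / \sum_j (e - a)_j ^+ 2]. *)
Lemma differentiable_slopes (R : realType) (r : nat) (h : 'rV[R]_r -> R)
    (a : 'rV[R]_r) :
  differentiable h a ->
  exists2 phi : 'I_r -> 'rV[R]_r -> R,
    forall k, {for a, continuous (phi k)} &
    forall e, h e - h a = \sum_k (e - a) 0 k * phi k e.
Proof.
move=> dh.
pose rho e := h e - h a - 'd h a (e - a).
pose q (e : 'rV[R]_r) := \sum_j (e - a) 0 j ^+ 2.
pose phi k e := 'd h a (delta_mx 0 k) + rho e * ((e - a) 0 k / q e).
have coordn (v : 'rV[R]_r) k : `|v 0 k| <= `|v|.
  rewrite [leRHS]/Num.Def.normr/= mx_normrE.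
  exact: (le_bigmax _ (fun i => `|v i.1 i.2|) (0, k)).
have rhoa : rho a = 0 by rewrite /rho !subrr linear0 subrr.
have q0 e : q e = 0 -> e = a.
  move=> /eqP; rewrite psumr_eq0 => [/allP qe|j _]; last exact: sqr_ge0.
  apply/subr0_eq/rowP => j; rewrite [RHS]mxE.
  by have := qe j (mem_index_enum _); rewrite sqrf_eq0 => /eqP.
(* The norm is the maximum norm and [q] the squared Euclidean one. The bound turns
   [eps * |e - a| * |(e - a)_k|], which dominates the weighted remainder before division, into at
   most [eps * q e]. *)
have qn e : `|e - a| ^+ 2 <= q e.
  rewrite [X in X ^+ 2]/Num.Def.normr/= mx_normrE.
  have : forall s : seq ('I_1 * 'I_r),
      (\big[Num.max/0]_(ij <- s) `|(e - a) ij.1 ij.2|) ^+ 2 <= q e.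
    elim=> [|[i j] s IH].
      by rewrite big_nil expr0n sumr_ge0 // => j _; exact: sqr_ge0.
    rewrite big_cons /Num.max; case: ifP => // _.
    rewrite /= ord1 /q (bigD1 j) //= real_normK ?num_real // lerDl sumr_ge0 // => k _.
    exact: sqr_ge0.
  exact.
exists phi => [k|e]; last first.
  have [qe|qe] := eqVneq (q e) 0.
    by rewrite (q0 _ qe) subrr big1 ?subrr // => k _; rewrite mxE mul0r.
  have -> : \sum_k (e - a) 0 k * phi k e = 'd h a (e - a) + rho e.
    rewrite [in 'd h a _](row_sum_delta (e - a)) linear_sum /=.
    under eq_bigr do rewrite /phi mulrDr.
    rewrite big_split /=; congr (_ + _).
      by apply: eq_bigr => k _; rewrite linearZ.
    under eq_bigr => k _ do rewrite mulrCA (mulrA ((e - a) 0 k)) -expr2 mulrA.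
    by rewrite -mulr_suml -mulr_sumr -/(q e) mulfK.
  by rewrite /rho [RHS]addrC subrK.
have phia : phi k a = 'd h a (delta_mx 0 k) by rewrite /phi rhoa mul0r addr0.
apply/(@cvgrPdist_le _ _ _ (nbhs a) _ (phi k)) => eps eps0; rewrite phia.
have /diff_locally /eqaddoP /(_ eps eps0) := dh.
rewrite [\forall x \near _, _ <= _](near_shift a 0) sub0r; apply: filterS => e /=.
rewrite !fctE subrK opprD addrA => H.
rewrite opprD addrA subrr add0r normrN.
have [ea|ea] := eqVneq e a; first by rewrite ea rhoa mul0r normr0 ltW.
have nea : 0 < `|e - a| by rewrite normr_gt0 subr_eq0.
have qe : 0 < q e by rewrite (lt_le_trans _ (qn e)) // exprn_gt0.
rewrite !normrM normfV (gtr0_norm qe) mulrA ler_pdivrMr //.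
apply: le_trans (_ : eps * `|e - a| * `|e - a| <= _); first by rewrite ler_pM.
by rewrite -mulrA -expr2 ler_pM2l.
Qed.

(** * Squared moduli and the Frobenius norm *)

Definition normsq (R : realType) (z : R[i]) : R :=
  complex.Re z ^+ 2 + complex.Im z ^+ 2.

Lemma normsqE (R : realType) (z : R[i]) : (normsq z)%:C = z * Num.conj z.
Proof. by rewrite /normsq add_Re2_Im2 normCK. Qed.

Lemma normsq_ge0 (R : realType) (z : R[i]) : 0 <= normsq z.
Proof. by rewrite addr_ge0 ?sqr_ge0. Qed.

Lemma normsqN (R : realType) (z : R[i]) : normsq (- z) = normsq z.
Proof. by case: z => x y; rewrite /normsq /= !sqrrN. Qed.

Lemma normsqZ (R : realType) (c : R) (z : R[i]) :
  normsq (c%:C * z) = c ^+ 2 * normsq z.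
Proof. by case: z => x y; rewrite /normsq /=; ring. Qed.

Lemma normsqM (R : realType) (z w : R[i]) :
  normsq (z * w) = normsq z * normsq w.
Proof. by case: z w => [x y] [s t]; rewrite /normsq /=; ring. Qed.

Lemma normsqD_le (R : realType) (z w : R[i]) :
  normsq (z + w) <= 2 * normsq z + 2 * normsq w.
Proof.
case: z w => [x y] [s t]; rewrite /normsq /= -subr_ge0.
by have := sqr_ge0 (x - s); have := sqr_ge0 (y - t); nra.
Qed.

(** The induction step of Cauchy-Schwarz without square roots: the cross term squared is at most
    [4 * normsq z * normsq w], hence at most [4 * x * y], hence at most [(x + y) ^+ 2]. *)
Lemma normsqD_sharp (R : realType) (z w : R[i]) (x y : R) :
  0 <= x -> 0 <= y -> normsq z * normsq w <= x * y ->
  normsq (z + w) <= normsq z + normsq w + (x + y).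
Proof.
case: z w => [a b] [s t]; rewrite /normsq /= => x0 y0 H.
suff : 2 * (a * s + b * t) <= x + y by nra.
rewrite (le_trans (ler_norm _)) // -ler_sqr ?nnegrE ?addr_ge0 //.
rewrite real_normK ?num_real // -subr_ge0.
have := sqr_ge0 (x - y); have := sqr_ge0 (a * t - b * s); nra.
Qed.

Lemma normsq_sum_mul (R : realType) (I : Type) (s : seq I) (a b : I -> R[i]) :
  normsq (\sum_(k <- s) a k * b k) <=
  (\sum_(k <- s) normsq (a k)) * (\sum_(k <- s) normsq (b k)).
Proof.
elim: s => [|k s IH].
  by rewrite !big_nil /normsq /= expr0n /= addr0 mul0r.
rewrite !big_cons addrC.
have A0 : 0 <= \sum_(k <- s) normsq (a k) by apply: sumr_ge0 => *; exact: normsq_ge0.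
have B0 : 0 <= \sum_(k <- s) normsq (b k) by apply: sumr_ge0 => *; exact: normsq_ge0.
have ak := normsq_ge0 (a k); have bk := normsq_ge0 (b k).
apply: le_trans (@normsqD_sharp _ _ _
  (normsq (a k) * \sum_(k <- s) normsq (b k))
  ((\sum_(k <- s) normsq (a k)) * normsq (b k)) _ _ _) _.
- exact: mulr_ge0.
- exact: mulr_ge0.
- rewrite normsqM [leRHS](_ : _ = (\sum_(k <- s) normsq (a k)) *
    (\sum_(k <- s) normsq (b k)) * (normsq (a k) * normsq (b k))); last by ring.
  by rewrite ler_wpM2r // mulr_ge0.
rewrite normsqM.
lra.
Qed.

(** The square of the Frobenius norm, valued in [R] and not in [R[i]]: it is polynomial in real and
    imaginary parts, so continuity is immediate and real arithmetic applies. The price is the factor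
    2 in [frobD_le]. *)
Definition frob (R : realType) (m n : nat) (X : 'M[R[i]]_(m, n)) : R :=
  \sum_i \sum_j normsq (X i j).

Lemma frobE (R : realType) (m n : nat) (X : 'M[R[i]]_(m, n)) :
  (frob X)%:C = \tr (X *m X^t*).
Proof.
rewrite /frob rmorph_sum; apply: eq_bigr => i _.
rewrite rmorph_sum !mxE; apply: eq_bigr => j _.
by rewrite !mxE -normsqE.
Qed.

Lemma frob_ge0 (R : realType) (m n : nat) (X : 'M[R[i]]_(m, n)) : 0 <= frob X.
Proof. by do 2!apply: sumr_ge0 => ? _; exact: normsq_ge0. Qed.

Lemma normsq_le_frob (R : realType) (m n : nat) (X : 'M[R[i]]_(m, n)) i j :
  normsq (X i j) <= frob X.
Proof.
rewrite /frob (bigD1 i) //= (bigD1 j) //= -addrA lerDl addr_ge0 //.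
  by apply: sumr_ge0 => *; exact: normsq_ge0.
by do 2!apply: sumr_ge0 => ? _; exact: normsq_ge0.
Qed.

Lemma frob_eq0 (R : realType) (m n : nat) (X : 'M[R[i]]_(m, n)) :
  frob X <= 0 -> X = 0.
Proof.
move=> X0; apply/matrixP => i j; rewrite mxE.
have := le_trans (normsq_le_frob X i j) X0.
case: (X i j) => x y; rewrite /normsq /= => H.
have x0 := sqr_ge0 x; have y0 := sqr_ge0 y.
have /eqP : x ^+ 2 = 0 by lra.
have /eqP : y ^+ 2 = 0 by lra.
by rewrite !sqrf_eq0 => /eqP -> /eqP ->.
Qed.

Lemma frob0 (R : realType) (m n : nat) : frob (0 : 'M[R[i]]_(m, n)) = 0.
Proof.
rewrite /frob big1 // => i _; rewrite big1 // => j _.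
by rewrite mxE /normsq /= expr0n addr0.
Qed.

Lemma frobN (R : realType) (m n : nat) (X : 'M[R[i]]_(m, n)) :
  frob (- X) = frob X.
Proof. by do 2!apply: eq_bigr => ? _; rewrite mxE normsqN. Qed.

Lemma frobD_le (R : realType) (m n : nat) (X Y : 'M[R[i]]_(m, n)) :
  frob (X + Y) <= 2 * frob X + 2 * frob Y.
Proof.
rewrite /frob !mulr_sumr -big_split /=; apply: ler_sum => i _.
rewrite !mulr_sumr -big_split /=; apply: ler_sum => j _.
by rewrite mxE normsqD_le.
Qed.

Lemma frobM_le (R : realType) (m n p : nat) (X : 'M[R[i]]_(m, n))
    (Y : 'M[R[i]]_(n, p)) :
  frob (X *m Y) <= frob X * frob Y.
Proof.
rewrite /frob mulr_suml; apply: ler_sum => i _.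
rewrite (exchange_big_dep xpredT) //= mulr_sumr; apply: ler_sum => j _.
by rewrite mxE normsq_sum_mul.
Qed.

Lemma frob_unitaryl (R : realType) (m n : nat) (U : 'M[R[i]]_m)
    (X : 'M[R[i]]_(m, n)) :
  U \is unitarymx -> frob (U *m X) = frob X.
Proof.
move=> Uu; apply: complexI; rewrite !frobE trmx_mul map_mxM mxtrace_mulC mulmxA.
by rewrite mulmxKtV // mxtrace_mulC.
Qed.

Lemma frob_unitaryr (R : realType) (m n : nat) (U : 'M[R[i]]_n)
    (X : 'M[R[i]]_(m, n)) :
  U \is unitarymx -> frob (X *m U) = frob X.
Proof.
move=> Uu; apply: complexI.
by rewrite !frobE trmx_mul map_mxM mulmxA mulmxtVK.
Qed.

Lemma frob_delta_row (R : realType) (n : nat) (j : 'I_n) :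
  frob (delta_mx 0 j : 'rV[R[i]]_n) = 1.
Proof.
rewrite /frob big_ord1 (bigD1 j) //= big1 => [|k kj].
  by rewrite mxE !eqxx /normsq /= expr1n expr0n !addr0.
by rewrite mxE eqxx (negPf kj) /normsq /= expr0n addr0.
Qed.

(** * Functions of Hermitian matrices and Sylvester equations *)

Section HermitianCalculus.
Variables (R : realType) (n : nat).
Implicit Types (A B X W : 'M[R[i]]_n) (f g : R -> R).

Definition reig A (j : 'I_n) : R := complex.Re (spectral_diag A 0 j).

Lemma hermfunE f A :
  hermfun f A = (spectralmx A)^t* *m
    diag_mx (\row_j (f (reig A j))%:C) *m spectralmx A.
Proof.
rewrite /hermfun; have -> : map_mx (fun z : R[i] => (f (complex.Re z))%:C)
    (spectral_diag A) = \row_j (f (reig A j))%:C.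
  by apply/rowP => j; rewrite !mxE.
by [].
Qed.

Lemma hermfun_conj f A :
  spectralmx A *m hermfun f A *m (spectralmx A)^t* =
  diag_mx (\row_j (f (reig A j))%:C).
Proof.
have Uu := spectral_unitarymx A.
by rewrite hermfunE !mulmxA (unitarymxP Uu) mul1mx -mulmxA (unitarymxP Uu) mulmx1.
Qed.

Lemma hermfun_id A : A \is hermsymmx -> hermfun id A = A.
Proof.
move=> Ah; rewrite [RHS](orthomx_spectralP (hermitian_normalmx Ah)).
rewrite (invmx_unitary (spectral_unitarymx A)) hermfunE.
suff -> : \row_j (id (reig A j))%:C = spectral_diag A by [].
apply/rowP => j; rewrite mxE RRe_real //.
exact: (mxOverP (hermitian_spectral_diag_real Ah)).
Qed.

Lemma eq_hermfun f g A : (forall j, f (reig A j) = g (reig A j)) ->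
  hermfun f A = hermfun g A.
Proof.
move=> fg; rewrite !hermfunE.
suff -> : \row_j (f (reig A j))%:C = \row_j (g (reig A j))%:C by [].
by apply/rowP => j; rewrite !mxE fg.
Qed.

Lemma hermfunM f g A :
  hermfun f A *m hermfun g A = hermfun (fun x => f x * g x) A.
Proof.
have Uu := spectral_unitarymx A.
rewrite !hermfunE !mulmxA (mulmxtVK _ Uu) -(mulmxA _ (diag_mx _) (diag_mx _)).
suff -> : diag_mx (\row_j (f (reig A j))%:C) *m diag_mx (\row_j (g (reig A j))%:C) =
  diag_mx (\row_j (f (reig A j) * g (reig A j))%:C) by [].
rewrite mulmx_diag; apply: congr1.
by apply/rowP => j; rewrite !mxE rmorphM.
Qed.

Lemma hermfunD f g A :
  hermfun f A + hermfun g A = hermfun (fun x => f x + g x) A.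
Proof.
rewrite !hermfunE -mulmxDl -mulmxDr.
suff -> : diag_mx (\row_j (f (reig A j))%:C) + diag_mx (\row_j (g (reig A j))%:C) =
  diag_mx (\row_j (f (reig A j) + g (reig A j))%:C) by [].
by apply/matrixP => i j; rewrite !mxE -mulrnDl rmorphD.
Qed.

Lemma hermfunN f A : - hermfun f A = hermfun (fun x => - f x) A.
Proof.
rewrite !hermfunE -mulNmx -mulmxN.
suff -> : - diag_mx (\row_j (f (reig A j))%:C) =
  diag_mx (\row_j (- f (reig A j))%:C) by [].
by apply/matrixP => i j; rewrite !mxE rmorphN mulNrn.
Qed.

Lemma hermfun_cst (c : R) A : hermfun (fun=> c) A = (c%:C)%:M.
Proof.
rewrite hermfunE (_ : \row__ _ = const_mx c%:C); last by apply/rowP => j; rewrite !mxE.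
rewrite diag_const_mx mul_mx_scalar -scalemxAl.
by rewrite (mulmx1C (unitarymxP (spectral_unitarymx A))) scalemx1.
Qed.

Lemma hermfun_comm f g A : hermfun f A *m hermfun g A = hermfun g A *m hermfun f A.
Proof. by rewrite !hermfunM; apply: eq_hermfun => j; rewrite mulrC. Qed.

Lemma frob_mul_hermfun f A m (x : 'M[R[i]]_(m, n)) :
  frob (x *m hermfun f A) =
  \sum_i \sum_j f (reig A j) ^+ 2 * normsq ((x *m (spectralmx A)^t*) i j).
Proof.
rewrite hermfunE !mulmxA frob_unitaryr ?spectral_unitarymx //.
do 2!apply: eq_bigr => ? _.
by rewrite mul_mx_diag !mxE mulrC normsqZ.
Qed.

Lemma frob_hermfun f A : frob (hermfun f A) = \sum_j f (reig A j) ^+ 2.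
Proof.
rewrite -(frob_unitaryl _ (spectral_unitarymx A)).
rewrite -(@frob_unitaryr _ _ _ ((spectralmx A)^t*)) ?trmxC_unitary ?spectral_unitarymx //.
rewrite hermfun_conj; apply: eq_bigr => i _; rewrite (bigD1 i) //= big1 => [|j ji].
  by rewrite !mxE eqxx mulr1n /normsq /= expr0n !addr0.
by rewrite !mxE eq_sym (negPf ji) mulr0n /normsq /= expr0n addr0.
Qed.

(* Solution of f(A) X + X f(B) = W, computed in eigenbases of A and B. *)
Definition sylvester f A B W : 'M[R[i]]_n :=
  (spectralmx A)^t* *m
    (\matrix_(i, j) ((spectralmx A *m W *m (spectralmx B)^t*) i j /
                     (f (reig A i) + f (reig B j))%:C))
    *m spectralmx B.

(** Eigenbases of [A] and [B] turn the Sylvester operator into an entrywise multiplication.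
    Solvability is then a division, and the lower bound follows because [frob] is unitarily
    invariant. *)
Lemma sylvester_sum f A B X :
  spectralmx A *m (hermfun f A *m X + X *m hermfun f B) *m (spectralmx B)^t* =
  \matrix_(i, j) ((f (reig A i) + f (reig B j))%:C *
     (spectralmx A *m X *m (spectralmx B)^t*) i j).
Proof.
have Au := spectral_unitarymx A; have Bu := spectral_unitarymx B.
rewrite mulmxDr mulmxDl (hermfunE _ A) (hermfunE _ B) !mulmxA (unitarymxP Au) mul1mx.
rewrite mulmxtVK // mul_mx_diag -!mulmxA mul_diag_mx.
apply/matrixP => i j; rewrite !mxE rmorphD mulrDl; congr (_ + _).
by rewrite mulrC.
Qed.

Lemma sylvester_eq f A B W :
  (forall i j, f (reig A i) + f (reig B j) != 0) ->
  hermfun f A *m sylvester f A B W + sylvester f A B W *m hermfun f B = W.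
Proof.
move=> f0; have Au := spectral_unitarymx A; have Bu := spectral_unitarymx B.
have can X : (spectralmx A)^t* *m (spectralmx A *m X *m (spectralmx B)^t*) *m
    spectralmx B = X.
  rewrite !mulmxA (mulmx1C (unitarymxP Au)) mul1mx -mulmxA.
  by rewrite (mulmx1C (unitarymxP Bu)) mulmx1.
rewrite -[LHS]can sylvester_sum -[RHS]can.
suff -> : \matrix_(i, j) ((f (reig A i) + f (reig B j))%:C *
    (spectralmx A *m sylvester f A B W *m (spectralmx B)^t*) i j) =
  spectralmx A *m W *m (spectralmx B)^t* by [].
apply/matrixP => i j; rewrite mxE /sylvester !mulmxA (unitarymxP Au) mul1mx.
by rewrite mulmxtVK // mxE mulrC divfK // fmorph_eq0.
Qed.

Lemma sylvester_bound f A B X (c : R) : 0 <= c ->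
  (forall i j, c <= f (reig A i) + f (reig B j)) ->
  c ^+ 2 * frob X <= frob (hermfun f A *m X + X *m hermfun f B).
Proof.
move=> c0 fc; have Au := spectral_unitarymx A.
have Bu : (spectralmx B)^t* \is unitarymx by rewrite trmxC_unitary spectral_unitarymx.
rewrite -(frob_unitaryl _ Au) -(frob_unitaryr _ Bu) -[leRHS](frob_unitaryl _ Au).
rewrite -[leRHS](frob_unitaryr _ Bu) sylvester_sum /frob mulr_sumr.
apply: ler_sum => i _; rewrite mulr_sumr; apply: ler_sum => j _.
rewrite [in leRHS]mxE normsqZ ler_wpM2r ?normsq_ge0 //.
by rewrite ler_sqr ?nnegrE // (le_trans c0).
Qed.

Lemma sylvester_unique f A B X W (c : R) : 0 < c ->
  (forall i j, c <= f (reig A i) + f (reig B j)) ->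
  hermfun f A *m X + X *m hermfun f B = W -> X = sylvester f A B W.
Proof.
move=> c0 fc XW; apply/subr0_eq/frob_eq0.
have := sylvester_bound (X - sylvester f A B W) (ltW c0) fc.
rewrite mulmxBr mulmxBl addrACA -opprD XW sylvester_eq => [|i j]; last first.
  by rewrite gt_eqF // (lt_le_trans c0).
by rewrite subrr frob0 pmulr_rle0 // exprn_gt0.
Qed.

(** Two diagonalizations are intertwined by [V], and [(reig A i - lam 0 j) * V i j = 0]: wherever
    [V] has a nonzero entry the two eigenvalues coincide, so their images under [f] do too. *)
Lemma hermfun_diag f A (Q : 'M[R[i]]_n) (lam : 'rV[R]_n) :
  A \is hermsymmx -> Q \is unitarymx ->
  Q^t* *m A *m Q = diag_mx (map_mx (fun x : R => x%:C) lam) ->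
  Q^t* *m hermfun f A *m Q = diag_mx (map_mx (fun x : R => (f x)%:C) lam).
Proof.
move=> Ah Qu QA; have Uu := spectral_unitarymx A.
pose V := spectralmx A *m Q.
have comm : diag_mx (\row_j (reig A j)%:C) *m V =
            V *m diag_mx (map_mx (fun x : R => x%:C) lam).
  have := hermfun_conj id A; rewrite (hermfun_id Ah) => <-.
  by rewrite -QA /V !mulmxA (mulmxtVK _ Qu) (mulmxKtV _ Uu (erefl _)).
have fcomm : diag_mx (\row_j (f (reig A j))%:C) *m V =
            V *m diag_mx (map_mx (fun x : R => (f x)%:C) lam).
  apply/matrixP => i j; move/matrixP/(_ i j): comm.
  rewrite !mul_diag_mx !mul_mx_diag !mxE => /eqP.
  rewrite mulrC -subr_eq0 -mulrBr mulf_eq0 => /orP[/eqP ->|].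
    by rewrite mulr0 mul0r.
  by rewrite subr_eq0 => /eqP/complexI ->; rewrite mulrC.
have QK : Q^t* *m (spectralmx A)^t* *m V = 1%:M.
  rewrite /V !mulmxA -(mulmxA _ _ (spectralmx A)) (mulmx1C (unitarymxP Uu)) mulmx1.
  exact: mulmx1C (unitarymxP Qu).
rewrite hermfunE !mulmxA -(mulmxA _ (spectralmx A)) -/V -mulmxA fcomm.
by rewrite mulmxA QK mul1mx.
Qed.

Definition gapped (mu c : R) A := forall j, c <= `|reig A j - mu|.

Lemma spectralmx_row A j : A \is hermsymmx ->
  row j (spectralmx A) *m A = (reig A j)%:C *: row j (spectralmx A).
Proof.
move=> Ah; have Uu := spectral_unitarymx A.
rewrite -row_mul -[X in row j (_ *m X)](hermfun_id Ah) hermfunE !mulmxA.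
by rewrite (unitarymxP Uu) mul1mx row_mul row_diag_mx mxE -scalemxAl -rowE.
Qed.

(** Let [x] be a unit eigenvector of [B] whose eigenvalue [t] is closer than [c / 2] to [mu]. Then
    [x (A - t) = x (A - B)] has norm below [c / 2], whereas every eigenvalue of [A] is at distance
    at least [c / 2] from [t]. *)
Lemma gapped_perturb mu c A B : 0 < c -> A \is hermsymmx -> B \is hermsymmx ->
  gapped mu c A -> frob (B - A) < (c / 2) ^+ 2 -> gapped mu (c / 2) B.
Proof.
move=> c0 Ah Bh gA AB j; rewrite leNgt; apply/negP => tmu.
set t := reig B j in tmu; set x := row j (spectralmx B).
have x1 : frob x = 1.
  by rewrite /x rowE frob_unitaryr ?spectral_unitarymx // frob_delta_row.
have : frob (x *m hermfun (fun y => y - t) A) <= frob (B - A).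
  rewrite -(hermfunD id (fun=> - t)) hermfun_id // hermfun_cst mulmxDr mul_mx_scalar.
  rewrite rmorphN scaleNr -spectralmx_row // -mulmxBr -(opprB B A) mulmxN frobN.
  by rewrite (le_trans (frobM_le _ _)) // x1 mul1r.
move/le_lt_trans/(_ AB); apply/negP; rewrite -leNgt.
rewrite frob_mul_hermfun.
have Au : (spectralmx A)^t* \is unitarymx by rewrite trmxC_unitary spectral_unitarymx.
have -> : (c / 2) ^+ 2 = (c / 2) ^+ 2 * frob (x *m (spectralmx A)^t*).
  by rewrite frob_unitaryr // x1 mulr1.
rewrite /frob mulr_sumr.
apply: ler_sum => i _; rewrite mulr_sumr; apply: ler_sum => k _.
rewrite ler_wpM2r ?normsq_ge0 // -[leRHS]real_normK ?num_real //.
rewrite ler_sqr ?nnegrE ?divr_ge0 ?(ltW c0) //.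
have := gA k; have := ler_normD (reig A k - t) (t - mu).
rewrite (_ : reig A k - t + (t - mu) = reig A k - mu); last by ring.
lra.
Qed.

End HermitianCalculus.

(** A resolvent-type identity: the increment of a solution solves an equation of the same kind,
    whose right-hand side contains only increments of the data and the old solution [X0]. *)
Lemma mulmx_sylvesterB (R : comNzRingType) (n : nat)
    (A A0 B B0 X X0 W W0 : 'M[R]_n) :
  A *m X + X *m B = W -> A0 *m X0 + X0 *m B0 = W0 ->
  A *m (X - X0) + (X - X0) *m B =
  W - W0 - (A - A0) *m X0 - X0 *m (B - B0).
Proof.
move=> <- <-; rewrite !(mulmxBl, mulmxBr).
by apply/matrixP => i j; rewrite !mxE; ring.
Qed.

Lemma Re_sum (R : realType) (I : Type) (s : seq I) (p : pred I) (F : I -> R[i]) :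
  complex.Re (\sum_(k <- s | p k) F k) = \sum_(k <- s | p k) complex.Re (F k).
Proof. by apply: (big_morph (@complex.Re R)) => [[? ?] [? ?]|]. Qed.

Lemma Im_sum (R : realType) (I : Type) (s : seq I) (p : pred I) (F : I -> R[i]) :
  complex.Im (\sum_(k <- s | p k) F k) = \sum_(k <- s | p k) complex.Im (F k).
Proof. by apply: (big_morph (@complex.Im R)) => [[? ?] [? ?]|]. Qed.

(** * Continuity of matrix functions *)

Section MatrixContinuity.
Variables (R : realType) (T : topologicalType).

Definition mx_continuous_at (m n : nat) (F : T -> 'M[R[i]]_(m, n)) (a : T) :=
  forall i j, {for a, continuous (fun x => complex.Re (F x i j))} /\
              {for a, continuous (fun x => complex.Im (F x i j))}.

Lemma mx_continuous_cst m n (A : 'M[R[i]]_(m, n)) a : mx_continuous_at (fun=> A) a.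
Proof. by move=> i j; split; exact: cst_continuous. Qed.

Lemma mx_continuousD m n (F G : T -> 'M[R[i]]_(m, n)) a :
  mx_continuous_at F a -> mx_continuous_at G a ->
  mx_continuous_at (fun x => F x + G x) a.
Proof.
move=> Fc Gc i j; have [F1 F2] := Fc i j; have [G1 G2] := Gc i j; split.
  rewrite (_ : (fun x => complex.Re _) =
    (fun x => complex.Re (F x i j) + complex.Re (G x i j))).
    exact: continuous_atD.
  by apply/funext => x; rewrite mxE; case: (F x i j) (G x i j) => [? ?] [].
rewrite (_ : (fun x => complex.Im _) =
  (fun x => complex.Im (F x i j) + complex.Im (G x i j))).
  exact: continuous_atD.
by apply/funext => x; rewrite mxE; case: (F x i j) (G x i j) => [? ?] [].
Qed.

Lemma mx_continuousN m n (F : T -> 'M[R[i]]_(m, n)) a :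
  mx_continuous_at F a -> mx_continuous_at (fun x => - F x) a.
Proof.
move=> Fc i j; have [F1 F2] := Fc i j; split.
  rewrite (_ : (fun x => complex.Re _) = (fun x => - complex.Re (F x i j))).
    exact: continuous_atN.
  by apply/funext => x; rewrite mxE; case: (F x i j).
rewrite (_ : (fun x => complex.Im _) = (fun x => - complex.Im (F x i j))).
  exact: continuous_atN.
by apply/funext => x; rewrite mxE; case: (F x i j).
Qed.

Lemma mx_continuousB m n (F G : T -> 'M[R[i]]_(m, n)) a :
  mx_continuous_at F a -> mx_continuous_at G a ->
  mx_continuous_at (fun x => F x - G x) a.
Proof. by move=> Fc Gc; apply: mx_continuousD => //; exact: mx_continuousN. Qed.

Lemma mx_continuousM m n p (F : T -> 'M[R[i]]_(m, n)) (G : T -> 'M[R[i]]_(n, p)) a :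
  mx_continuous_at F a -> mx_continuous_at G a ->
  mx_continuous_at (fun x => F x *m G x) a.
Proof.
move=> Fc Gc i j; split.
  rewrite (_ : (fun x => complex.Re _) = (fun x => \sum_k
     (complex.Re (F x i k) * complex.Re (G x k j) +
      - (complex.Im (F x i k) * complex.Im (G x k j))))).
    apply: continuous_at_sum => k _.
    have [F1 F2] := Fc i k; have [G1 G2] := Gc k j.
    by apply: continuous_atD; [|apply: continuous_atN]; apply: continuous_atM.
  apply/funext => x; rewrite mxE Re_sum; apply: eq_bigr => k _.
  by case: (F x i k) (G x k j) => [? ?] [].
rewrite (_ : (fun x => complex.Im _) = (fun x => \sum_k
   (complex.Re (F x i k) * complex.Im (G x k j) +
    complex.Im (F x i k) * complex.Re (G x k j)))).
  apply: continuous_at_sum => k _.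
  have [F1 F2] := Fc i k; have [G1 G2] := Gc k j.
  by apply: continuous_atD; apply: continuous_atM.
apply/funext => x; rewrite mxE Im_sum; apply: eq_bigr => k _.
by case: (F x i k) (G x k j) => [? ?] [].
Qed.

Lemma continuous_frob m n (F : T -> 'M[R[i]]_(m, n)) a :
  mx_continuous_at F a -> {for a, continuous (fun x => frob (F x))}.
Proof.
move=> Fc; apply: continuous_at_sum => i _; apply: continuous_at_sum => j _.
have [F1 F2] := Fc i j.
exact: continuous_atD (continuous_atM F1 F1) (continuous_atM F2 F2).
Qed.

Lemma mx_continuous_squeeze m n (F : T -> 'M[R[i]]_(m, n)) (g : T -> R) a :
  (\forall x \near a, frob (F x - F a) <= g x) ->
  {for a, continuous g} -> g a = 0 -> mx_continuous_at F a.
Proof.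
move=> Fg gc ga.
suff H (eps : R) : 0 < eps -> \forall x \near a, forall i j,
    `|complex.Re (F a i j) - complex.Re (F x i j)| <= eps /\
    `|complex.Im (F a i j) - complex.Im (F x i j)| <= eps.
  move=> i j; split.
    apply/(@cvgrPdist_le _ _ _ (nbhs a) _ (fun x => complex.Re (F x i j))) => e e0.
    by have := H e e0; apply: filterS => x /(_ i j) [].
  apply/(@cvgrPdist_le _ _ _ (nbhs a) _ (fun x => complex.Im (F x i j))) => e e0.
  by have := H e e0; apply: filterS => x /(_ i j) [].
move=> eps0; have eps2 : 0 < eps ^+ 2 by rewrite exprn_gt0.
have /cvgrPdist_le/(_ _ eps2) := gc; rewrite ga => gn.
apply: filterS2 Fg gn => x Fx gx i j.
have {}Fx : normsq ((F x - F a) i j) <= eps ^+ 2.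
  rewrite (le_trans (normsq_le_frob _ i j)) // (le_trans Fx) //.
  by rewrite (le_trans _ gx) // sub0r normrN ler_norm.
move: Fx; rewrite !mxE; case: (F a i j) (F x i j) => [x1 y1] [x2 y2].
rewrite /normsq /= => Fx.
have sx := sqr_ge0 (x2 - x1); have sy := sqr_ge0 (y2 - y1).
split; rewrite -ler_sqr ?nnegrE ?(ltW eps0) // real_normK ?num_real // -sqrrN opprB; lra.
Qed.

(** The eigenbases inside [sylvester] need not vary continuously. The increment of the solution is
    bounded instead by [V], the right-hand side of its own equation, which is continuous and
    vanishes at [a]. *)
Lemma sylvester_continuous n (f : R -> R) (A B W : T -> 'M[R[i]]_n) a c :
  0 < c ->
  (\forall x \near a, forall i j, c <= f (reig (A x) i) + f (reig (B x) j)) ->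
  mx_continuous_at (fun x => hermfun f (A x)) a ->
  mx_continuous_at (fun x => hermfun f (B x)) a ->
  mx_continuous_at W a ->
  mx_continuous_at (fun x => sylvester f (A x) (B x) (W x)) a.
Proof.
move=> c0 fc Ac Bc Wc; have fca := nbhs_singleton fc.
pose S x := sylvester f (A x) (B x) (W x).
pose V x := W x - W a - (hermfun f (A x) - hermfun f (A a)) *m S a -
  S a *m (hermfun f (B x) - hermfun f (B a)).
have Vc : mx_continuous_at V a.
  have kc (C : 'M[R[i]]_n) := mx_continuous_cst C a.
  exact: mx_continuousB (mx_continuousB (mx_continuousB Wc (kc _))
    (mx_continuousM (mx_continuousB Ac (kc _)) (kc _)))
    (mx_continuousM (kc _) (mx_continuousB Bc (kc _))).
apply: (@mx_continuous_squeeze _ _ _ (fun x => (c ^+ 2)^-1 * frob (V x))).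
- apply: filterS fc => x fcx; rewrite ler_pdivlMl ?exprn_gt0 //.
  rewrite (le_trans (sylvester_bound _ (ltW c0) fcx)) //.
  have cn0 y i j : c <= f (reig (A y) i) + f (reig (B y) j) ->
    f (reig (A y) i) + f (reig (B y) j) != 0.
    by move=> h; rewrite gt_eqF // (lt_le_trans c0).
  rewrite /V; set W0 := W a; set W1 := W x.
  rewrite (mulmx_sylvesterB (sylvester_eq _ (fun i j => cn0 _ i j (fcx i j)))
    (sylvester_eq _ (fun i j => cn0 _ i j (fca i j)))) //.
- by apply: continuous_atM; [exact: cst_continuous|exact: continuous_frob].
- by rewrite /V !subrr mulmx0 mul0mx !subrr frob0 mulr0.
Qed.

End MatrixContinuity.

(** * Slopes of matrix functions *)

Section Slopes.
Variables (R : realType) (r : nat).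
Implicit Type a : 'rV[R]_r.

(* Caratheodory's form of differentiability: the [k]-th partial derivative of
   [F] at [a] is [Phi k a]. *)
Definition mx_slopes (m n : nat) (F : 'rV[R]_r -> 'M[R[i]]_(m, n)) a
    (Phi : 'I_r -> 'rV[R]_r -> 'M[R[i]]_(m, n)) :=
  (forall k, mx_continuous_at (Phi k) a) /\
  \forall e \near a, F e - F a = \sum_k ((e - a) 0 k)%:C *: Phi k e.

Lemma mx_slopes_differentiable m n (F : 'rV[R]_r -> 'M[R[i]]_(m, n)) a Phi :
  mx_slopes F a Phi -> forall i j,
  [/\ differentiable (fun e => complex.Re (F e i j)) a,
      differentiable (fun e => complex.Im (F e i j)) a,
      forall v, 'D_v (fun e => complex.Re (F e i j)) a =
        \sum_k v 0 k * complex.Re (Phi k a i j) &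
      forall v, 'D_v (fun e => complex.Im (F e i j)) a =
        \sum_k v 0 k * complex.Im (Phi k a i j)].
Proof.
move=> [Phic FPhi] i j.
have [|dR DR] := @slopes_differentiable _ _ (fun e => complex.Re (F e i j)) a
    (fun k e => complex.Re (Phi k e i j)) (fun k => (Phic k i j).1).
  apply: filterS FPhi => e /matrixP/(_ i j)/(congr1 (@complex.Re R)).
  rewrite summxE Re_sum !mxE => E.
  transitivity (complex.Re (F e i j - F a i j)).
    by case: (F e i j) (F a i j) => [? ?] [].
  rewrite E; apply: eq_bigr => k _; rewrite !mxE.
  by case: (Phi k e i j) => ? ? /=; rewrite mul0r subr0.
have [|dI DI] := @slopes_differentiable _ _ (fun e => complex.Im (F e i j)) a
    (fun k e => complex.Im (Phi k e i j)) (fun k => (Phic k i j).2).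
  apply: filterS FPhi => e /matrixP/(_ i j)/(congr1 (@complex.Im R)).
  rewrite summxE Im_sum !mxE => E.
  transitivity (complex.Im (F e i j - F a i j)).
    by case: (F e i j) (F a i j) => [? ?] [].
  rewrite E; apply: eq_bigr => k _; rewrite !mxE.
  by case: (Phi k e i j) => ? ? /=; rewrite mul0r addr0.
by split.
Qed.

Lemma mx_slopes_continuous m n (F : 'rV[R]_r -> 'M[R[i]]_(m, n)) a Phi :
  mx_slopes F a Phi -> mx_continuous_at F a.
Proof.
by move=> /mx_slopes_differentiable FPhi i j; have [d1 d2 _ _] := FPhi i j; split;
  exact: differentiable_continuous.
Qed.

Lemma pderivE m n (F : 'rV[R]_r -> 'M[R[i]]_(m, n)) a Phi k :
  mx_slopes F a Phi -> pderiv k F a = Phi k a.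
Proof.
move=> /mx_slopes_differentiable FPhi; apply/matrixP => i j; rewrite mxE.
have [_ _ -> ->] := FPhi i j.
have sum1 (x : 'I_r -> R) : \sum_l (delta_mx 0 k : 'rV[R]_r) 0 l * x l = x k.
  rewrite (bigD1 k) //= mxE !eqxx mul1r big1 ?addr0 // => l lk.
  by rewrite mxE eqxx (negPf lk) mul0r.
by rewrite !sum1; case: (Phi k a i j).
Qed.

Lemma differentiable_mx_slopes m n (F : 'rV[R]_r -> 'M[R[i]]_(m, n)) a :
  (forall i j, differentiable (fun e => complex.Re (F e i j)) a /\
               differentiable (fun e => complex.Im (F e i j)) a) ->
  exists Phi, mx_slopes F a Phi.
Proof.
move=> dF.
pose slopes (h : 'rV[R]_r -> R) (phi : 'I_r -> 'rV[R]_r -> R) :=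
  (forall k, {for a, continuous (phi k)}) /\
  (forall e, h e - h a = \sum_k (e - a) 0 k * phi k e).
have [phiR phiRP] : exists phi, forall ij : 'I_m * 'I_n,
    slopes (fun e => complex.Re (F e ij.1 ij.2)) (phi ij).
  have sl ij := cid2 (differentiable_slopes (dF ij.1 ij.2).1).
  exists (fun ij => s2val (sl ij)) => ij.
  by split; [exact: (s2valP (sl ij))|exact: (s2valP' (sl ij))].
have [phiI phiIP] : exists phi, forall ij : 'I_m * 'I_n,
    slopes (fun e => complex.Im (F e ij.1 ij.2)) (phi ij).
  have sl ij := cid2 (differentiable_slopes (dF ij.1 ij.2).2).
  exists (fun ij => s2val (sl ij)) => ij.
  by split; [exact: (s2valP (sl ij))|exact: (s2valP' (sl ij))].
exists (fun k e => \matrix_(i, j) (phiR (i, j) k e +i* phiI (i, j) k e)).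
split=> [k i j|].
  have [cR _] := phiRP (i, j); have [cI _] := phiIP (i, j); split.
    rewrite (_ : (fun x => _) = phiR (i, j) k); first exact: cR.
    by apply/funext => x; rewrite mxE.
  rewrite (_ : (fun x => _) = phiI (i, j) k); first exact: cI.
  by apply/funext => x; rewrite mxE.
apply: (@filterE _ (nbhs a)) => e; apply/matrixP => i j; rewrite summxE.
have [_ /(_ e)/= eR] := phiRP (i, j); have [_ /(_ e)/= eI] := phiIP (i, j).
apply/eqP; rewrite eq_complex Re_sum Im_sum; apply/andP; split; apply/eqP.
  transitivity (complex.Re (F e i j) - complex.Re (F a i j)).
    by rewrite !mxE; case: (F e i j) (F a i j) => [? ?] [].
  by rewrite eR; apply: eq_bigr => k _; rewrite !mxE /= mul0r subr0.
transitivity (complex.Im (F e i j) - complex.Im (F a i j)).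
  by rewrite !mxE; case: (F e i j) (F a i j) => [? ?] [].
by rewrite eI; apply: eq_bigr => k _; rewrite !mxE /= mul0r addr0.
Qed.

Lemma mx_slopes_cst m n (A : 'M[R[i]]_(m, n)) a : mx_slopes (fun=> A) a (fun _ _ => 0).
Proof.
split; first by move=> k; exact: mx_continuous_cst.
by apply: (@filterE _ (nbhs a)) => e; rewrite subrr big1 // => k _; rewrite scaler0.
Qed.

Lemma mx_slopesD m n (F G : 'rV[R]_r -> 'M[R[i]]_(m, n)) a Phi Psi :
  mx_slopes F a Phi -> mx_slopes G a Psi ->
  mx_slopes (fun e => F e + G e) a (fun k e => Phi k e + Psi k e).
Proof.
move=> [Fc FE] [Gc GE]; split; first by move=> k; exact: mx_continuousD.
apply: filterS2 FE GE => e FE GE; rewrite opprD addrACA FE GE -big_split /=.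
by apply: eq_bigr => k _; rewrite scalerDr.
Qed.

Lemma mx_slopesN m n (F : 'rV[R]_r -> 'M[R[i]]_(m, n)) a Phi :
  mx_slopes F a Phi -> mx_slopes (fun e => - F e) a (fun k e => - Phi k e).
Proof.
move=> [Fc FE]; split; first by move=> k; exact: mx_continuousN.
apply: filterS FE => e FE; rewrite -opprD FE -sumrN.
by apply: eq_bigr => k _; rewrite scalerN.
Qed.

Lemma mx_slopesB m n (F G : 'rV[R]_r -> 'M[R[i]]_(m, n)) a Phi Psi :
  mx_slopes F a Phi -> mx_slopes G a Psi ->
  mx_slopes (fun e => F e - G e) a (fun k e => Phi k e - Psi k e).
Proof. by move=> FPhi GPsi; apply: mx_slopesD => //; exact: mx_slopesN. Qed.

(** Taking [G] at the moving point and [F] at the base point makes the product rule exact: no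
    product of two increments is left over. *)
Lemma mx_slopesM m n p (F : 'rV[R]_r -> 'M[R[i]]_(m, n))
    (G : 'rV[R]_r -> 'M[R[i]]_(n, p)) a Phi Psi :
  mx_slopes F a Phi -> mx_slopes G a Psi ->
  mx_slopes (fun e => F e *m G e) a
    (fun k e => Phi k e *m G e + F a *m Psi k e).
Proof.
move=> FPhi GPsi; have Gca := mx_slopes_continuous GPsi.
move: FPhi GPsi => [Fc FE] [Gc GE]; split.
  move=> k; apply: mx_continuousD; apply: mx_continuousM => //.
  exact: mx_continuous_cst.
apply: filterS2 FE GE => e FE GE.
have -> : F e *m G e - F a *m G a = (F e - F a) *m G e + F a *m (G e - G a).
  by rewrite mulmxBl mulmxBr addrA subrK.
rewrite FE GE mulmx_suml mulmx_sumr -big_split /=; apply: eq_bigr => k _.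
by rewrite scalerDr -scalemxAl -scalemxAr.
Qed.

Lemma mx_slopes_near m n (F G : 'rV[R]_r -> 'M[R[i]]_(m, n)) a Phi :
  (\forall e \near a, F e = G e) -> mx_slopes F a Phi -> mx_slopes G a Phi.
Proof.
move=> FG [Fc FE]; split => //; have FGa := nbhs_singleton FG.
by apply: filterS2 FG FE => e <-; rewrite -FGa.
Qed.

Lemma near_differentiable (g h : 'rV[R]_r -> R) a :
  (\forall e \near a, g e = h e) -> differentiable g a -> differentiable h a.
Proof.
move=> gh /differentiable_slopes[phi phic gE].
have gha := nbhs_singleton gh.
have [|//] := slopes_differentiable phic (h := h).
by apply: filterS gh => e <-; rewrite -gha.
Qed.

End Slopes.

(** * Increments of projectors and slopes of Sylvester solutions *)

Lemma mulmx_sylvesterBr (R : comNzRingType) (n : nat)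
    (A A0 B B0 X X0 W W0 : 'M[R]_n) :
  A *m X + X *m B = W -> A0 *m X0 + X0 *m B0 = W0 ->
  A *m (X - X0) + (X - X0) *m B0 =
  W - W0 - X *m (B - B0) - (A - A0) *m X0.
Proof.
move=> <- <-; rewrite !(mulmxBl, mulmxBr).
by apply/matrixP => i j; rewrite !mxE; ring.
Qed.

(** [K] stands for [H - mu]. Idempotence gives [B P = - K P] and [P0 B0 = - K0 P0]; the remaining
    terms regroup so that only [K - K0] appears as an increment, always between a projector at one
    point and a complementary projector at the other. *)
Lemma mulmx_projectorB (R : comNzRingType) (n : nat)
    (B B0 K K0 P P0 : 'M[R]_n) :
  P *m P = P -> P0 *m P0 = P0 -> K *m P = P *m K -> K0 *m P0 = P0 *m K0 ->
  B = K *m (1%:M - (P + P)) -> B0 = K0 *m (1%:M - (P0 + P0)) ->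
  B *m (P - P0) + (P - P0) *m B0 =
  - (P *m (K - K0) *m (1%:M - P0) + (1%:M - P) *m (K - K0) *m P0).
Proof.
move=> PP PP0 KP KP0 -> ->.
rewrite !(mulmxDl, mulmxDr, mulmxN, mulNmx, mulmx1, mul1mx) !mulmxA.
rewrite -(mulmxA K P P) PP -!KP -KP0 -(mulmxA K0 P0 P0) PP0.
by apply/matrixP => i j; rewrite !mxE; ring.
Qed.

(** Linearity in the right-hand side moves the coordinates of [e - a] through the solution operator,
    so that slopes of a solution are again solutions. *)
Lemma sylvester_is_linear (R : realType) (n : nat) (f : R -> R)
    (A B : 'M[R[i]]_n) : linear (sylvester f A B).
Proof.
move=> c X Y; rewrite /sylvester scalemxAl scalemxAr -mulmxDl -mulmxDr.
congr (_ *m _ *m _); rewrite mulmxDr mulmxDl -scalemxAr -scalemxAl.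
move: (_ *m X *m _) (_ *m Y *m _) => X' Y'.
by apply/matrixP => i j; rewrite !mxE mulrDl mulrA.
Qed.

HB.instance Definition _ (R : realType) (n : nat) (f : R -> R)
    (A B : 'M[R[i]]_n) :=
  GRing.isLinear.Build R[i] 'M[R[i]]_n 'M[R[i]]_n *:%R (sylvester f A B)
    (sylvester_is_linear f A B).

(** The increment of the solution [X] solves the equation with left coefficient at [e] and right
    coefficient at [a]; its right-hand side is linear in the slopes of the data but also contains
    [X e], whence the continuity of [X] is settled beforehand. *)
Lemma mx_slopes_sylvester (R : realType) (r n : nat) (f : R -> R)
    (A W : 'rV[R]_r -> 'M[R[i]]_n) (a : 'rV[R]_r) (c : R) PhiB PhiW :
  0 < c ->
  (\forall e \near a, forall j, c <= f (reig (A e) j)) ->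
  mx_slopes (fun e => hermfun f (A e)) a PhiB -> mx_slopes W a PhiW ->
  exists Phi, mx_slopes (fun e => sylvester f (A e) (A e) (W e)) a Phi.
Proof.
move=> c0 fc sB sW; have fca := nbhs_singleton fc.
pose X e := sylvester f (A e) (A e) (W e).
have Bc := mx_slopes_continuous sB; have Wc := mx_slopes_continuous sW.
have pos e1 e2 : (forall j, c <= f (reig (A e1) j)) ->
    (forall j, c <= f (reig (A e2) j)) ->
    forall i j, c <= f (reig (A e1) i) + f (reig (A e2) j).
  by move=> h1 h2 i j; rewrite (le_trans (h1 i)) // lerDl (le_trans (ltW c0)).
have Xc : mx_continuous_at X a.
  apply: (sylvester_continuous c0 _ Bc Bc Wc).
  by apply: filterS fc => e fce; exact: pos.
have [Bk BE] := sB; have [Wk WE] := sW.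
exists (fun k e => sylvester f (A e) (A a)
  (PhiW k e - X e *m PhiB k e - PhiB k e *m X a)); split.
  move=> k; apply: (sylvester_continuous c0).
  - by apply: filterS fc => e fce; exact: pos.
  - exact: Bc.
  - exact: mx_continuous_cst.
  - exact: mx_continuousB (mx_continuousB (Wk k) (mx_continuousM Xc (Bk k)))
      (mx_continuousM (Bk k) (mx_continuous_cst _ _)).
apply: filterS3 fc BE WE => e fce BE WE.
have ne e1 : (forall j, c <= f (reig (A e1) j)) ->
    forall i j, f (reig (A e1) i) + f (reig (A e1) j) != 0.
  by move=> h i j; rewrite gt_eqF // (lt_le_trans c0) // pos.
under eq_bigr do rewrite -linearZ.
rewrite -linear_sum; apply: (sylvester_unique c0); first exact: pos.
have := sylvester_eq (W e) (ne e fce); have := sylvester_eq (W a) (ne a fca).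
rewrite -/(X e) -/(X a) => Ea Ee.
rewrite (mulmx_sylvesterBr Ee Ea) BE WE mulmx_sumr mulmx_suml -!sumrB.
apply: eq_bigr => k _.
by rewrite !scalerBr -scalemxAl -scalemxAr.
Qed.

Lemma hermfun_1 (R : realType) (n : nat) (A : 'M[R[i]]_n) :
  hermfun (fun=> 1) A = 1%:M.
Proof. by rewrite hermfun_cst. Qed.

(** * The spectral projector along the family [H] *)

Section Projector.
Variables (R : realType) (r n : nat) (H : 'rV[R]_r -> 'M[R[i]]_n) (mu : R).
Hypothesis H_herm : forall e, H e \is hermsymmx.

Let P e := hermfun (occupation mu) (H e).
Let dist (x : R) := `|x - mu|.
Let B e := hermfun dist (H e).

Lemma occupation_idem e : P e *m P e = P e.
Proof.
rewrite hermfunM; apply: eq_hermfun => j.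
by rewrite /occupation; case: ifP; rewrite ?mulr1 ?mulr0.
Qed.

Lemma occupation_comm e : H e *m P e = P e *m H e.
Proof.
by have := hermfun_comm id (occupation mu) (H e); rewrite hermfun_id.
Qed.

Lemma dist_occupation e : B e = (H e - mu%:C%:M) *m (1%:M - (P e + P e)).
Proof.
have -> : H e - mu%:C%:M = hermfun (fun x => x - mu) (H e).
  by rewrite -(hermfunD id (fun=> - mu)) hermfun_id // hermfun_cst rmorphN raddfN.
have -> : 1%:M - (P e + P e) =
    hermfun (fun x => 1 - (occupation mu x + occupation mu x)) (H e).
  rewrite -(hermfunD (fun=> 1) (fun x => - (occupation mu x + occupation mu x))).
  by rewrite -hermfunN -(hermfunD (occupation mu) (occupation mu)) hermfun_1.
rewrite hermfunM; apply: eq_hermfun => j; rewrite /dist /occupation.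
case: ltP => h; first by rewrite ltr0_norm ?subr_lt0 //; ring.
by rewrite ger0_norm ?subr_ge0 //; ring.
Qed.

Lemma sylvester_occupation e a :
  B e *m (P e - P a) + (P e - P a) *m B a =
  - (P e *m (H e - H a) *m (1%:M - P a) + (1%:M - P e) *m (H e - H a) *m P a).
Proof.
rewrite (mulmx_projectorB (occupation_idem e) (occupation_idem a)
  _ _ (dist_occupation e) (dist_occupation a)).
- by rewrite opprB addrA subrK.
- by rewrite mulmxBl mulmxBr occupation_comm scalar_mxC.
- by rewrite mulmxBl mulmxBr occupation_comm scalar_mxC.
Qed.

(** A bound uniform in [e], available before [P] is known to be continuous: the squared occupations
    are at most 1. *)
Lemma frob_occupation e : frob (P e) <= n%:R /\ frob (1%:M - P e) <= n%:R.
Proof.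
split; last rewrite -(hermfun_1 (H e)) hermfunN hermfunD.
  rewrite frob_hermfun -[leRHS]mulr1 -[n in leRHS]card_ord mulr_natl -sumr_const.
  by apply: ler_sum => j _; rewrite /occupation; case: ifP; rewrite ?expr1n // expr0n.
rewrite frob_hermfun -[leRHS]mulr1 -[n in leRHS]card_ord mulr_natl -sumr_const.
apply: ler_sum => j _; rewrite /occupation.
by case: ifP; rewrite ?subrr ?subr0 ?expr1n // expr0n.
Qed.

Lemma gapped_near a c : 0 < c -> mx_continuous_at H a -> gapped mu c (H a) ->
  \forall e \near a, gapped mu (c / 2) (H e).
Proof.
move=> c0 Hc ga.
have Dc : mx_continuous_at (fun e => H e - H a) a.
  by apply: mx_continuousB => //; exact: mx_continuous_cst.
have c2 : 0 < (c / 2) ^+ 2 by rewrite exprn_gt0 ?divr_gt0.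
have /cvgrPdist_lt/(_ _ c2) := continuous_frob Dc.
rewrite subrr frob0; apply: filterS => e.
rewrite sub0r normrN => /(le_lt_trans (ler_norm _)); exact: gapped_perturb.
Qed.

Lemma occupation_continuous a c : 0 < c -> mx_continuous_at H a ->
  gapped mu c (H a) -> mx_continuous_at P a.
Proof.
move=> c0 Hc ga.
(* The factors 2 come from [frobD_le], the factors [n] from the uniform bound on [P e] and its
   complement. *)
pose K := 2 * (n%:R * frob (1%:M - P a)) + 2 * (n%:R * frob (P a)).
apply: (@mx_continuous_squeeze _ _ _ _ _
  (fun e => (c ^+ 2)^-1 * K * frob (H e - H a))).
- apply: (@filterE _ (nbhs a)) => e; rewrite -mulrA ler_pdivlMl ?exprn_gt0 //.
  (* The gap at [a] bounds the second summand, and the first is nonnegative whatever [e] is. *)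
  have cd i j : c <= dist (reig (H e) i) + dist (reig (H a) j).
    by rewrite (le_trans (ga j)) // lerDr normr_ge0.
  rewrite (le_trans (sylvester_bound _ (ltW c0) cd)) // sylvester_occupation frobN.
  have [P1 P2] := frob_occupation e.
  rewrite (le_trans (frobD_le _ _)) // /K [leRHS]mulrDl.
  rewrite -(mulrA 2) -(mulrA 2); apply: lerD; rewrite ler_pM2l //.
    rewrite (le_trans (frobM_le _ _)) // [leRHS]mulrAC.
    rewrite ler_wpM2r ?frob_ge0 // (le_trans (frobM_le _ _)) //.
    by rewrite ler_wpM2r ?frob_ge0.
  rewrite (le_trans (frobM_le _ _)) // [leRHS]mulrAC.
  rewrite ler_wpM2r ?frob_ge0 // (le_trans (frobM_le _ _)) //.
  by rewrite ler_wpM2r ?frob_ge0.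
- apply: continuous_atM; first exact: cst_continuous.
  by apply: continuous_frob; apply: mx_continuousB => //; exact: mx_continuous_cst.
- by rewrite subrr frob0 mulr0.
Qed.

Lemma dist_continuous a c : 0 < c -> mx_continuous_at H a ->
  gapped mu c (H a) -> mx_continuous_at B a.
Proof.
move=> c0 Hc ga; have Pc := occupation_continuous c0 Hc ga.
rewrite (_ : B = fun e => (H e - mu%:C%:M) *m (1%:M - (P e + P e))); last first.
  by apply/funext => e; rewrite dist_occupation.
have kc (C : 'M[R[i]]_n) := mx_continuous_cst C a.
exact: mx_continuousM (mx_continuousB Hc (kc _))
  (mx_continuousB (kc _) (mx_continuousD Pc Pc)).
Qed.

(** [P0] is the projector at the base point and [P1] the one at the moving point. For [P1 = P0] this
    is minus the off-diagonal part of [K] with respect to [P0]. *)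
Definition occupation_slope (K P0 P1 : 'M[R[i]]_n) :=
  - (P1 *m K *m (1%:M - P0) + (1%:M - P1) *m K *m P0).

(** At [e = a] the slopes give the partial derivatives of [P] in closed form, the first order
    perturbation formula. *)
Lemma occupation_slopes a c Phi : 0 < c -> gapped mu c (H a) ->
  mx_slopes H a Phi ->
  mx_slopes P a (fun k e =>
    sylvester dist (H e) (H a) (occupation_slope (Phi k e) (P a) (P e))).
Proof.
move=> c0 ga sH; have Hc := mx_slopes_continuous sH.
have Pc := occupation_continuous c0 Hc ga; have Bc := dist_continuous c0 Hc ga.
have cd e i j : c <= dist (reig (H e) i) + dist (reig (H a) j).
  by rewrite (le_trans (ga j)) // lerDr normr_ge0.
have [Hk HE] := sH; split.
  move=> k; apply: (sylvester_continuous c0).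
  - by apply: (@filterE _ (nbhs a)) => e; exact: cd.
  - exact: Bc.
  - exact: mx_continuous_cst.
  - have kc (C : 'M[R[i]]_n) := mx_continuous_cst C a.
    exact: mx_continuousN (mx_continuousD (mx_continuousM (mx_continuousM Pc (Hk k))
      (kc _)) (mx_continuousM (mx_continuousM (mx_continuousB (kc _) Pc) (Hk k))
      (kc _))).
apply: filterS HE => e HE.
under eq_bigr do rewrite -linearZ.
rewrite -linear_sum; apply: (sylvester_unique c0) => //.
rewrite -/(B e) -/(B a) sylvester_occupation HE.
rewrite !mulmx_sumr !mulmx_suml -big_split /= -sumrN; apply: eq_bigr => k _.
by rewrite scalerN scalerDr -!scalemxAr -!scalemxAl.
Qed.

End Projector.

(** * Multi-indices of degree one and two *)

Section MultiIndex.
Variables (R : realType) (r m n : nat).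
Implicit Type F : 'rV[R]_r -> 'M[R[i]]_(m, n).

Let mpd (s : seq 'I_r) (alpha : 'I_r -> nat) F :=
  foldr (fun k G => iter (alpha k) (@pderiv R r m n k) G) F s.

Lemma foldr_pderiv0 s (alpha : 'I_r -> nat) F :
  {in s, forall i, alpha i = 0%N} -> mpd s alpha F = F.
Proof.
elim: s => //= x s IH a0; rewrite (a0 x) ?mem_head //= IH // => i si.
by rewrite a0 // inE si orbT.
Qed.

Lemma foldr_pderiv1 s (alpha : 'I_r -> nat) F j : uniq s -> j \in s ->
  {in s, forall i, alpha i = (i == j) :> nat} -> mpd s alpha F = pderiv j F.
Proof.
elim: s => //= x s IH /andP[xs us]; rewrite inE => jxs aE.
have aS : {in s, forall i, alpha i = (i == j) :> nat}.
  by move=> i si; rewrite aE // inE si orbT.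
rewrite (aE x) ?mem_head //; have [xj|xj] := eqVneq x j.
  rewrite /= foldr_pderiv0 ?xj // => i si; rewrite aS //.
  by case: eqVneq => // ij; rewrite xj -ij si in xs.
by rewrite /= IH //; rewrite eq_sym (negPf xj) in jxs.
Qed.

(** The position of [j] and [k] in [s] decides the order of differentiation. [F] is quantified
    inside each alternative, so that [H] and [P] are differentiated in the same order. *)
Lemma foldr_pderiv2 s (alpha : 'I_r -> nat) j k : uniq s -> j \in s -> k \in s ->
  {in s, forall i, alpha i = (i == j) + (i == k)}%N ->
  (forall F, mpd s alpha F = pderiv j (pderiv k F)) \/
  (forall F, mpd s alpha F = pderiv k (pderiv j F)).
Proof.
elim: s => //= x s IH /andP[xs us]; rewrite !inE => jxs kxs aE.
have aS : {in s, forall i, alpha i = (i == j) + (i == k)}%N.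
  by move=> i si; rewrite aE // inE si orbT.
have sx i : i \in s -> (i == x) = false.
  by move=> si; apply/eqP => ix; rewrite -ix si in xs.
rewrite (aE x) ?mem_head //; move: jxs kxs.
have [xj|xj] := eqVneq x j; have [xk|xk] := eqVneq x k => /=.
- move=> _ _; left=> F; rewrite -xj -xk foldr_pderiv0 // => i si.
  by rewrite aS // -xj -xk sx.
- move=> _ kxs; left=> F; rewrite -xj; congr (pderiv _ _).
  apply: foldr_pderiv1 => // i si.
  by rewrite aS // -xj sx.
- move=> jxs _; right=> F; rewrite -xk; congr (pderiv _ _).
  apply: foldr_pderiv1 => // i si.
  by rewrite aS // -xk sx // addn0.
- by move=> jxs kxs; apply: IH.
Qed.

End MultiIndex.

Lemma mdegree1P (r : nat) (beta : {ffun 'I_r -> nat}) : mdegree beta = 1%N ->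
  exists j, forall i, beta i = (i == j) :> nat.
Proof.
rewrite /mdegree => b1.
have [j bj] : exists j, beta j != 0%N.
  apply/existsP; apply: contra_eqT b1 => /existsPn b0.
  by rewrite big1 // => i _; apply/eqP; have := b0 i; rewrite negbK.
exists j => i; move: b1; rewrite (bigD1 j) //=.
have [-> |ij] := eqVneq i j; first by case: (beta j) bj => [|[|]].
by rewrite (bigD1 i) //=; case: (beta j) bj => [|[|]] // _; case: (beta i).
Qed.

Lemma mpderiv1 (R : realType) (r m n : nat) (beta : {ffun 'I_r -> nat}) j
    (F : 'rV[R]_r -> 'M[R[i]]_(m, n)) :
  (forall i, beta i = (i == j) :> nat) -> mpderiv beta F = pderiv j F.
Proof. by move=> bE; apply: foldr_pderiv1; rewrite ?enum_uniq ?mem_enum. Qed.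

Lemma mpderiv2 (R : realType) (r m n : nat) (beta gamma : {ffun 'I_r -> nat}) j k :
  (forall i, beta i = (i == j) :> nat) -> (forall i, gamma i = (i == k) :> nat) ->
  (forall F : 'rV[R]_r -> 'M[R[i]]_(m, n),
     mpderiv (beta + gamma) F = pderiv j (pderiv k F)) \/
  (forall F : 'rV[R]_r -> 'M[R[i]]_(m, n),
     mpderiv (beta + gamma) F = pderiv k (pderiv j F)).
Proof.
move=> bE gE; apply: (@foldr_pderiv2 R r m n (enum 'I_r) (beta + gamma)%R j k);
  rewrite ?enum_uniq ?mem_enum // => i _.
by rewrite ffunE bE gE.
Qed.

(** * Second derivatives of products and of the projector *)

Lemma mx_twice_slopes (R : realType) (r m n : nat)
    (F : 'rV[R]_r -> 'M[R[i]]_(m, n)) a :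
  mx_twice_differentiable F a <->
  (\forall e \near a, exists Phi, mx_slopes F e Phi) /\
  (forall k, exists Psi, mx_slopes (pderiv k F) a Psi).
Proof.
split=> [dF|[F1 F2] i j].
  split=> [|k].
    have : \forall e \near a, forall ij : 'I_m * 'I_n,
        differentiable (fun e => complex.Re (F e ij.1 ij.2)) e /\
        differentiable (fun e => complex.Im (F e ij.1 ij.2)) e.
      apply: (@filter_forall _ _ (fun (ij : 'I_m * 'I_n) e =>
        differentiable (fun e => complex.Re (F e ij.1 ij.2)) e /\
        differentiable (fun e => complex.Im (F e ij.1 ij.2)) e) (nbhs a) _).
      move=> [i j]; have [[dR _] [dI _]] := dF i j.
      by apply: filterS2 dR dI => e; split.
    apply: filterS => e dFe; apply: differentiable_mx_slopes => i j.
    exact: (dFe (i, j)).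
  apply: differentiable_mx_slopes => i j; have [[_ dR] [_ dI]] := dF i j; split.
    rewrite (_ : (fun e => _) =
      (fun e => 'D_(delta_mx 0 k) (fun x => complex.Re (F x i j)) e)).
      exact: dR.
    by apply/funext => e; rewrite mxE.
  rewrite (_ : (fun e => _) =
    (fun e => 'D_(delta_mx 0 k) (fun x => complex.Im (F x i j)) e)).
    exact: dI.
  by apply/funext => e; rewrite mxE.
have lin (phi : 'I_r -> 'rV[R]_r -> R) (v : 'rV[R]_r) :
    (forall k, differentiable (phi k) a) ->
    differentiable (fun e => \sum_k v 0 k * phi k e) a.
  move=> dphi.
  have [p pP] : exists p : 'I_r -> 'I_r -> 'rV[R]_r -> R, forall k,
      (forall l, {for a, continuous (p k l)}) /\
      forall e, phi k e - phi k a = \sum_l (e - a) 0 l * p k l e.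
    have sl k := cid2 (differentiable_slopes (dphi k)).
    exists (fun k => s2val (sl k)) => k.
    by split; [exact: (s2valP (sl k))|exact: (s2valP' (sl k))].
  have [||//] := @slopes_differentiable R r (fun e => \sum_k v 0 k * phi k e) a
    (fun l e => \sum_k v 0 k * p k l e).
    move=> l; apply: continuous_at_sum => k _; apply: continuous_atM.
      exact: cst_continuous.
    by have [] := pP k.
  apply: (@filterE _ (nbhs a)) => e; rewrite -sumrB.
  under eq_bigr => k _ do rewrite -mulrBr (pP k).2 mulr_sumr.
  rewrite exchange_big /=; apply: eq_bigr => l _.
  by rewrite mulr_sumr; apply: eq_bigr => k _; rewrite mulrCA.
have dk k := F2 k.
split; split.
- by apply: filterS F1 => e [Phi /mx_slopes_differentiable /(_ i j)[]].
(* An arbitrary direction reduces to the coordinate ones: wherever slopes exist, hence near [a], the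
   derivative along [v] is the combination of partial derivatives with coefficients [v 0 k]. *)
- move=> v; apply: (near_differentiable
    (g := fun e => \sum_k v 0 k * complex.Re (pderiv k F e i j))).
    apply: filterS F1 => e [Phi FPhi].
    have [_ _ -> _] := mx_slopes_differentiable FPhi i j.
    by apply: eq_bigr => k _; rewrite (pderivE k FPhi).
  apply: lin => k; have [Psi /mx_slopes_differentiable/(_ i j)[]] := F2 k.
  by [].
- by apply: filterS F1 => e [Phi /mx_slopes_differentiable /(_ i j)[]].
- move=> v; apply: (near_differentiable
    (g := fun e => \sum_k v 0 k * complex.Im (pderiv k F e i j))).
    apply: filterS F1 => e [Phi FPhi].
    have [_ _ _ ->] := mx_slopes_differentiable FPhi i j.
    by apply: eq_bigr => k _; rewrite (pderivE k FPhi).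
  apply: lin => k; have [Psi /mx_slopes_differentiable/(_ i j)[]] := F2 k.
  by [].
Qed.

Lemma pderivM (R : realType) (r m n p : nat)
    (F : 'rV[R]_r -> 'M[R[i]]_(m, n)) (G : 'rV[R]_r -> 'M[R[i]]_(n, p)) a k Phi Psi :
  mx_slopes F a Phi -> mx_slopes G a Psi ->
  pderiv k (fun e => F e *m G e) a = pderiv k F a *m G a + F a *m pderiv k G a.
Proof.
move=> sF sG.
by rewrite (pderivE k (mx_slopesM sF sG)) (pderivE k sF) (pderivE k sG).
Qed.

Lemma pderiv2M (R : realType) (r m n p : nat)
    (F : 'rV[R]_r -> 'M[R[i]]_(m, n)) (G : 'rV[R]_r -> 'M[R[i]]_(n, p)) a j k :
  mx_twice_differentiable F a -> mx_twice_differentiable G a ->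
  pderiv j (pderiv k (fun e => F e *m G e)) a =
  pderiv j (pderiv k F) a *m G a + pderiv k F a *m pderiv j G a +
  (pderiv j F a *m pderiv k G a + F a *m pderiv j (pderiv k G) a).
Proof.
move=> /mx_twice_slopes[F1 F2] /mx_twice_slopes[G1 G2].
have [PF sF] := nbhs_singleton F1; have [PG sG] := nbhs_singleton G1.
have [PFk sFk] := F2 k; have [PGk sGk] := G2 k.
(* The first order product rule is needed as an equality of functions near [a], since it is
   differentiated once more. *)
have E : \forall e \near a, pderiv k F e *m G e + F e *m pderiv k G e =
    pderiv k (fun e => F e *m G e) e.
  apply: filterS2 F1 G1 => e [Phi FPhi] [Psi GPsi].
  by rewrite (pderivM k FPhi GPsi).
have S := mx_slopes_near E (mx_slopesD (mx_slopesM sFk sG) (mx_slopesM sF sGk)).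
rewrite (pderivE j S) (pderivE j sFk) (pderivE j sG) (pderivE j sF) (pderivE j sGk).
by [].
Qed.

Lemma occupation_twice_differentiable (R : realType) (r n : nat)
    (H : 'rV[R]_r -> 'M[R[i]]_n) (mu c : R) (a : 'rV[R]_r) :
  (forall e, H e \is hermsymmx) -> mx_twice_differentiable H a ->
  0 < c -> gapped mu c (H a) ->
  mx_twice_differentiable (fun e => hermfun (occupation mu) (H e)) a.
Proof.
move=> Hh /mx_twice_slopes[H1 H2] c0 ga.
have [PH sH] := nbhs_singleton H1.
have Hc := mx_slopes_continuous sH.
have c20 : 0 < c / 2 by rewrite divr_gt0.
have gn := gapped_near Hh c0 Hc ga.
set P := fun e => hermfun (occupation mu) (H e).
pose dist (x : R) := `|x - mu|.
pose W k e := occupation_slope (pderiv k H e) (P e) (P e).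
have [PP sP] : exists Phi, mx_slopes P a Phi.
  by eexists; exact: (occupation_slopes Hh c0 ga sH).
(* The absolute value is written as [(H - mu) (1 - 2 P)], whose factors already have slopes at
   [a]. *)
have [PB sB] : exists Phi, mx_slopes (fun e => hermfun dist (H e)) a Phi.
  have s1 := mx_slopes_cst (1%:M : 'M[R[i]]_n) a.
  have sm := mx_slopes_cst (mu%:C%:M : 'M[R[i]]_n) a.
  rewrite (_ : (fun e => _) = fun e => (H e - mu%:C%:M) *m (1%:M - (P e + P e))).
    by eexists; exact: mx_slopesM (mx_slopesB sH sm) (mx_slopesB s1 (mx_slopesD sP sP)).
  by apply/funext => e; exact: dist_occupation.
apply/mx_twice_slopes; split.
  (* Each nearby [e] now serves as its own base point, with gap [c / 2]. *)
  apply: filterS2 gn H1 => e ge [Phi sHe].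
  by eexists; exact: (occupation_slopes Hh c20 ge sHe).
move=> k.
have [PW sW] : exists Phi, mx_slopes (W k) a Phi.
  have [PHk sHk] := H2 k; have s1 := mx_slopes_cst (1%:M : 'M[R[i]]_n) a.
  eexists; exact: mx_slopesN (mx_slopesD
    (mx_slopesM (mx_slopesM sP sHk) (mx_slopesB s1 sP))
    (mx_slopesM (mx_slopesM (mx_slopesB s1 sP) sHk) sP)).
have [Psi sT] := mx_slopes_sylvester c20 gn sB sW.
exists Psi; apply: mx_slopes_near sT.
apply: filterS2 gn H1 => e ge [Phi sHe].
by rewrite (pderivE k (occupation_slopes Hh c20 ge sHe)) /W (pderivE k sHe).
Qed.

(** * Blocks of the second derivative in the eigenbasis of [H(0)] *)

Lemma conj_row_mx (C : numClosedFieldType) (ne nv : nat) (Q Y : 'M[C]_(ne + nv)) :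
  let Ql : 'M[C]_(ne + nv, ne) := lsubmx Q in let Qr : 'M[C]_(ne + nv, nv) := rsubmx Q in
  Q^t* *m Y *m Q = block_mx (Ql^t* *m Y *m Ql) (Ql^t* *m Y *m Qr)
                            (Qr^t* *m Y *m Ql) (Qr^t* *m Y *m Qr).
Proof.
move=> Ql Qr; rewrite -[Q in LHS]hsubmxK tr_row_mx map_col_mx.
by rewrite mul_col_mx mul_col_row.
Qed.

(** In the eigenbasis [P] is diagonal with entries 1 (occupied) and 0 (virtual). The first identity
    reads [x = 2 x + s] on the occupied block, so [x = - s], and [x = s] on the virtual one. Off the
    diagonal the second gives [(lam_i - lam_j) x = ha + w] (occupied-virtual) or [- (ha - w)]
    (virtual-occupied); the sign of [lam_i - lam_j] turns both quotients into
    [- 1 / |lam_i - lam_j|] times the entry of [M12] or [M21]. *)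
Lemma second_order_blocks (R : realType) (ne nv : nat) (mu : R)
    (lam : 'rV[R]_(ne + nv)) (Q H P X Ha Hb Hg Pb Pg : 'M[R[i]]_(ne + nv)) :
  Q \is unitarymx ->
  Q^t* *m H *m Q = diag_mx (map_mx (fun x : R => x%:C) lam) ->
  Q^t* *m P *m Q = diag_mx (map_mx (fun x : R => (occupation mu x)%:C) lam) ->
  (forall i : 'I_ne, lam 0 (lshift nv i) < mu) ->
  (forall j : 'I_nv, mu < lam 0 (rshift ne j)) ->
  X = X *m P + P *m X + (Pb *m Pg + Pg *m Pb) ->
  H *m X - X *m H =
    P *m Ha - Ha *m P + (Pb *m Hg - Hb *m Pg + Pg *m Hb - Hg *m Pb) ->
  let Qocc : 'M[R[i]]_(ne + nv, ne) := lsubmx Q in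
  let Qvir : 'M[R[i]]_(ne + nv, nv) := rsubmx Q in
  let D := \matrix_(i < ne + nv, j < ne + nv)
    if (lam 0 i - mu) * (lam 0 j - mu) < 0
    then (- (1 / `|lam 0 i - lam 0 j|))%:C else 0 in
  let M12 := Qocc^t* *m
    (Ha + Pb *m Hg - Hb *m Pg + Pg *m Hb - Hg *m Pb) *m Qvir in
  let M21 := Qvir^t* *m
    (Ha + Hb *m Pg - Pb *m Hg + Hg *m Pb - Pg *m Hb) *m Qocc in
  Q^t* *m X *m Q =
    hadamard D (block_mx 0 M12 M21 0) +
    block_mx (- (Qocc^t* *m (Pb *m Pg + Pg *m Pb) *m Qocc)) 0
             0 (Qvir^t* *m (Pb *m Pg + Pg *m Pb) *m Qvir).
Proof.
move=> Qu QH QP locc lvir XE HXE Qocc Qvir D M12 M21.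
pose cj (Y : 'M[R[i]]_(ne + nv)) := Q^t* *m Y *m Q.
have cjM Y Z : cj (Y *m Z) = cj Y *m cj Z.
  by rewrite /cj !mulmxA mulmxtVK.
have cjD Y Z : cj (Y + Z) = cj Y + cj Z by rewrite /cj mulmxDr mulmxDl.
have cjN Y : cj (- Y) = - cj Y by rewrite /cj mulmxN mulNmx.
have blk Y : cj Y = _ := conj_row_mx Q Y.
pose x := cj X; pose ha := cj Ha; pose s := cj (Pb *m Pg + Pg *m Pb).
pose w := cj (Pb *m Hg - Hb *m Pg + Pg *m Hb - Hg *m Pb).
have E1 i j : x i j = x i j * (occupation mu (lam 0 j))%:C +
    (occupation mu (lam 0 i))%:C * x i j + s i j.
  have := congr1 cj XE; rewrite !cjD !(cjM X) !(cjM P) -cjD -/x -/s.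
  rewrite [cj P]QP mul_mx_diag mul_diag_mx => /matrixP/(_ i j) E.
  by rewrite [LHS]E !mxE.
have E2 i j : (lam 0 i)%:C * x i j - x i j * (lam 0 j)%:C =
    (occupation mu (lam 0 i))%:C * ha i j - ha i j * (occupation mu (lam 0 j))%:C + w i j.
  have := congr1 cj HXE.
  rewrite (cjD (H *m X)) (cjD (_ - _)) (cjD (P *m Ha)) !cjN.
  rewrite !(cjM H) !(cjM X) !(cjM P) !(cjM Ha).
  rewrite -/x -/ha -/w [cj P]QP [cj H]QH !mul_mx_diag !mul_diag_mx.
  by move=> /matrixP/(_ i j); rewrite !mxE.
have M12E i j : M12 i j = ha (lshift nv i) (rshift ne j) + w (lshift nv i) (rshift ne j).
  transitivity (cj (Ha + (Pb *m Hg - Hb *m Pg + Pg *m Hb - Hg *m Pb))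
    (lshift nv i) (rshift ne j)); last by rewrite cjD mxE.
  by rewrite blk block_mxEur !addrA.
have M21E i j : M21 i j = ha (rshift ne i) (lshift nv j) - w (rshift ne i) (lshift nv j).
  transitivity (cj (Ha - (Pb *m Hg - Hb *m Pg + Pg *m Hb - Hg *m Pb))
    (rshift ne i) (lshift nv j)); last by rewrite cjD cjN !mxE.
  rewrite blk block_mxEdl /M21.
  suff -> : Ha + Hb *m Pg - Pb *m Hg + Hg *m Pb - Pg *m Hb =
    Ha - (Pb *m Hg - Hb *m Pg + Pg *m Hb - Hg *m Pb) by [].
  move: (Hb *m Pg) (Pb *m Hg) (Hg *m Pb) (Pg *m Hb) => y1 y2 y3 y4.
  by apply/matrixP => k l; rewrite !mxE; ring.
have sl i j : (Qocc^t* *m (Pb *m Pg + Pg *m Pb) *m Qocc) i j =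
    s (lshift nv i) (lshift nv j).
  by rewrite /s blk block_mxEul.
have sr i j : (Qvir^t* *m (Pb *m Pg + Pg *m Pb) *m Qvir) i j =
    s (rshift ne i) (rshift ne j).
  by rewrite /s blk block_mxEdr.
have ol i : occupation mu (lam 0 (lshift nv i)) = 1 by rewrite /occupation locc.
have or j : occupation mu (lam 0 (rshift ne j)) = 0.
  by rewrite /occupation ltNge (ltW (lvir j)).
apply/matrixP => i j; rewrite -[LHS]/(x i j) [RHS]mxE [X in _ = X + _]mxE.
have := E1 i j; have := E2 i j; move: sl sr.
move: (_ *m _ *m Qocc) (_ *m _ *m Qvir) => S1 S2 sl sr.
clearbody x ha s w M12 M21.
case: (split_ordP i) => {}i ->; case: (split_ordP j) => {}j ->.
- rewrite !block_mxEul !ol rmorph1 !mulr1 !mul1r => _ {}E1; rewrite !mxE mulr0 add0r sl.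
  apply/eqP; rewrite -addr_eq0; apply/eqP/(addrI (x (lshift nv i) (lshift nv j))).
  by rewrite addr0 addrA -E1.
- rewrite !block_mxEur ol or rmorph0 rmorph1 mulr0 mul1r subr0 -M12E => {}E2 _.
  have li := locc i; have lj := lvir j.
  have lt0 : lam 0 (lshift nv i) - lam 0 (rshift ne j) < 0 by lra.
  rewrite !mxE addr0 ifT; last by nra.
  rewrite (ltr0_norm lt0) div1r invrN opprK -E2 (mulrC (x _ _)) -mulrBl -rmorphB.
  by rewrite mulrA -rmorphM /= mulVf ?lt_eqF // mul1r.
- rewrite !block_mxEdl ol or rmorph0 rmorph1 mulr1 mul0r sub0r => {}E2 _.
  have li := lvir i; have lj := locc j.
  have gt0 : 0 < lam 0 (rshift ne i) - lam 0 (lshift nv j) by lra.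
  rewrite !mxE addr0 ifT; last by nra.
  rewrite (gtr0_norm gt0) div1r M21E -[ha _ _ - _]opprB [w _ _ - _]addrC -E2.
  rewrite (mulrC (x _ _)) -mulrBl -rmorphB rmorphN mulrNN.
  by rewrite mulrA -rmorphM /= mulVf ?gt_eqF // mul1r.
- rewrite !block_mxEdr !or rmorph0 !mulr0 !mul0r !add0r => _ {}E1.
  rewrite !mxE mulr0 add0r sr.
  by rewrite [LHS]E1.
Qed.

Lemma spectral_gap (R : realType) (n : nat) (A : 'M[R[i]]_n) (mu : R) :
  A \is hermsymmx -> ~~ eigenvalue A mu%:C ->
  exists2 c, 0 < c & gapped mu c A.
Proof.
move=> Ah Amu.
have ne j : 0 < `|reig A j - mu|.
  rewrite normr_gt0 subr_eq0; apply: contraNneq Amu => jmu.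
  apply/eigenvalueP; exists (row j (spectralmx A)).
    by rewrite spectralmx_row // jmu.
  apply/negP => /eqP r0; have := frob_delta_row R j.
  rewrite -(frob_unitaryr _ (spectral_unitarymx A)) -rowE r0 frob0 => /eqP.
  by rewrite eq_sym oner_eq0.
(* The initial value 1 keeps the minimum positive, also over an empty set of indices. *)
exists (\big[Num.min/1]_j `|reig A j - mu|) => [|j].
  by apply: (big_ind (fun y => 0 < y)) => // y z y0 z0; rewrite lt_min y0.
by rewrite (bigD1 j) //= ge_min lexx.
Qed.

(** The letters are the Leibniz terms of the second derivatives of [H P] and [P H]: [d] and [a']
    contain the second derivative of [P], [a] and [d'] that of [H], the others first derivatives
    only. *)
Lemma commutator_eq (R : comNzRingType) (m n : nat)
    (a b c d a' b' c' d' : 'M[R]_(m, n)) :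
  a + b + (c + d) = a' + b' + (c' + d') ->
  d - a' = d' - a + (c' - c + b' - b).
Proof.
move=> E; have -> : d = a' + b' + (c' + d') - (a + b + c).
  by rewrite -E; apply/matrixP => i j; rewrite !mxE; ring.
by apply/matrixP => i j; rewrite !mxE; ring.
Qed.

Lemma occupation_pderiv2 (R : realType) (r n : nat)
    (H : 'rV[R]_r -> 'M[R[i]]_n) (mu : R) (a : 'rV[R]_r) (j k : 'I_r) :
  (forall e, H e \is hermsymmx) ->
  let P := fun e => hermfun (occupation mu) (H e) in
  mx_twice_differentiable H a -> mx_twice_differentiable P a ->
  let X := pderiv j (pderiv k P) a in let Y := pderiv j (pderiv k H) a in
  let Hj := pderiv j H a in let Hk := pderiv k H a in
  let Pj := pderiv j P a in let Pk := pderiv k P a in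
  X = X *m P a + P a *m X + (Pj *m Pk + Pk *m Pj) /\
  H a *m X - X *m H a =
    P a *m Y - Y *m P a + (Pj *m Hk - Hj *m Pk + Pk *m Hj - Hk *m Pj).
Proof.
move=> Hh P H2 P2 X Y Hj Hk Pj Pk; split.
  have PP : P = fun e => P e *m P e by apply/funext => e; rewrite occupation_idem.
  have := congr1 (fun F => pderiv j (pderiv k F) a) PP.
  rewrite (pderiv2M j k P2 P2) -/X -/Pj -/Pk => E; rewrite [LHS]E.
  clearbody X Pj Pk; move: (P a) => P0.
  by rewrite (addrC (Pj *m Pk)) addrACA (addrC (Pk *m Pj)).
have HP : (fun e => H e *m P e) = fun e => P e *m H e.
  by apply/funext => e; exact: occupation_comm.
have := congr1 (fun F => pderiv j (pderiv k F) a) HP.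
rewrite (pderiv2M j k H2 P2) (pderiv2M j k P2 H2) -/X -/Pj -/Pk -/Hj -/Hk -/Y.
clearbody X Y Hj Hk Pj Pk; move: (P a) (H a) => P0 H0.
exact: commutator_eq.
Qed.

Unset Implicit Arguments.
Set Strict Implicit.

Theorem mainTheorem5 (R : realType) (r ne nv : nat)
  (H : 'rV[R]_r -> 'M[R[i]]_(ne + nv)) (mu : R)
  (lam : 'rV[R]_(ne + nv)) (Q : 'M[R[i]]_(ne + nv))
  (ne_bounds : (1 <= ne < ne + nv)%N)
  (H_herm : forall e, H e \is hermsymmx)
  (H_diff : mx_twice_differentiable H 0)
  (lam_eigen : char_poly (H 0) = \prod_i ('X - ((lam 0 i)%:C)%:P))
  (lam_sorted : forall i j : 'I_(ne + nv), (i <= j)%N -> lam 0 i <= lam 0 j)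
  (mu_gap : \forall x \near mu, ~~ eigenvalue (H 0) x%:C)
  (lam_homo : forall i : 'I_(ne + nv), i.+1 = ne -> lam 0 i < mu)
  (lam_lumo : forall i : 'I_(ne + nv), i = ne :> nat -> mu < lam 0 i)
  (Q_unitary : Q \is unitarymx)
  (Q_diag : Q^t* *m H 0 *m Q = diag_mx (map_mx (fun x : R => x%:C) lam)) :
  let P := fun e => hermfun (occupation mu) (H e) in
  let Qocc : 'M[R[i]]_(ne + nv, ne) := lsubmx Q in
  let Qvir : 'M[R[i]]_(ne + nv, nv) := rsubmx Q in
  let D := \matrix_(i < ne + nv, j < ne + nv)
    if (lam 0 i - mu) * (lam 0 j - mu) < 0
    then (- (1 / `|lam 0 i - lam 0 j|))%:C else 0 in
  mx_twice_differentiable P 0 /\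
  forall alpha beta gamma : {ffun 'I_r -> nat},
    alpha = beta + gamma -> mdegree beta = 1%N -> mdegree gamma = 1%N ->
    let Ha := mpderiv alpha H 0 in
    let Hb := mpderiv beta H 0 in
    let Hg := mpderiv gamma H 0 in
    let Pa := mpderiv alpha P 0 in
    let Pb := mpderiv beta P 0 in
    let Pg := mpderiv gamma P 0 in
    let M12 := Qocc^t* *m
      (Ha + Pb *m Hg - Hb *m Pg + Pg *m Hb - Hg *m Pb) *m Qvir in
    let M21 := Qvir^t* *m
      (Ha + Hb *m Pg - Pb *m Hg + Hg *m Pb - Pg *m Hb) *m Qocc in
    Q^t* *m Pa *m Q =
      hadamard D (block_mx 0 M12 M21 0) +
      block_mx (- (Qocc^t* *m (Pb *m Pg + Pg *m Pb) *m Qocc)) 0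
               0 (Qvir^t* *m (Pb *m Pg + Pg *m Pb) *m Qvir).
Proof.
move=> P Qocc Qvir D.
have [ne0 nev] := andP ne_bounds.
have locc (i : 'I_ne) : lam 0 (lshift nv i) < mu.
  (* Indices start at 0, so the highest occupied level is [ne.-1]; sortedness passes its bound to
     the lower ones. *)
  have lt : (ne.-1 < ne + nv)%N by rewrite (leq_ltn_trans (leq_pred _)).
  apply: le_lt_trans (lam_homo (Ordinal lt) (prednK ne0)).
  by apply: lam_sorted => /=; rewrite -ltnS (prednK ne0).
have lvir (j : 'I_nv) : mu < lam 0 (rshift ne j).
  apply: lt_le_trans (lam_lumo (Ordinal nev) erefl) _.
  by apply: lam_sorted => /=; rewrite leq_addr.
have [c c0 gc] := spectral_gap (H_herm 0) (nbhs_singleton mu_gap).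
have P_diff : mx_twice_differentiable P 0.
  exact: occupation_twice_differentiable H_herm H_diff c0 gc.
split=> // alpha beta gamma -> /mdegree1P[j bj] /mdegree1P[k gk].
have QP := hermfun_diag (occupation mu) (H_herm 0) Q_unitary Q_diag.
rewrite (mpderiv1 _ bj) (mpderiv1 _ bj) (mpderiv1 _ gk) (mpderiv1 _ gk).
have [mpE|mpE] := mpderiv2 R (ne + nv) (ne + nv) bj gk; rewrite !mpE.
  have [E1 E2] := occupation_pderiv2 j k H_herm H_diff P_diff.
  exact: second_order_blocks Q_unitary Q_diag QP locc lvir E1 E2.
(* For the opposite order of differentiation the two identities hold with [j] and [k] exchanged, and
   they only need their sums reordered. *)
have [E1 E2] := occupation_pderiv2 k j H_herm H_diff P_diff.
apply: second_order_blocks Q_unitary Q_diag QP locc lvir _ _.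
  exact: etrans E1 (congr1 (+%R _) (addrC _ _)).
have swap (V : zmodType) (y z s t : V) : y - z + s - t = s - t + y - z.
  by rewrite -addrA addrC addrA.
exact: etrans E2 (congr1 (+%R _) (swap _ _ _ _ _)).
Qed.
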